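(* Let $T,B:\mathfrak H\to\mathfrak K$ be closed linear relations such that $B^*T$ is selfadjoint, and let $B_0:=B^*\cap(\mathfrak K\times\mathrm{ran}\,B^*T)$. If $\ker B^*\subseteq\ker T^*\oplus\mathrm{mul}\,T$, then the following assertions are equivalent: (i) $T^*T\ge\eta\,\overline{B_0}\,T\ge0$ for some $\eta>0$; (ii) $T\subseteq YB_0^*$ has a solution $Y$ with $Y^{-1}\in B^+(\mathfrak K)$. In this case, $Y$ can be chosen such that $\ker T^*\oplus\mathrm{mul}\,T\subseteq\mathrm{mul}\,Y$ and $$B^*T=\overline{B_0}\,T=\overline{B_0}\,Y B_0^{*}=T^*B_0^{*}.$$ In particular, the following statements are equivalent: (iii) $T^*T\ge\eta\,\overline{B_0}\,T$ for some $\eta>0$, with $\mathrm{ran}\,T^*\subseteq\mathrm{ran}\,\overline{B_0}$; (iv) $T^*=\overline{B_0}\,Y\,\dot{+}\,(\ker T^*\times\{0\})$ has a solution $Y$ with $Y^{-1}\in B^+(\mathfrak K)$. In this case, $\mathrm{mul}\,T\oplus\ker T^*=\mathrm{mul}\,Y$.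
   Context: $\mathfrak H,\mathfrak K$ are complex Hilbert spaces; $B^+(\mathfrak K)$ is the set of bounded everywhere defined nonnegative selfadjoint operators on $\mathfrak K$. A linear relation $T:\mathfrak H\to\mathfrak K$ is a linear subspace of $\mathfrak H\times\mathfrak K$, with the usual domain, range, kernel, multivalued part $\mathrm{mul}\,T=\{y:(0,y)\in T\}$, inverse $T^{-1}=\{(y,x):(x,y)\in T\}$, products and closure; operators are identified with their graphs. $Y$ is a linear relation in $\mathfrak K$ (it may be multivalued) whose inverse is an operator in $B^+(\mathfrak K)$. The adjoint is $T^*=\{(x,x')\in\mathfrak K\times\mathfrak H:\langle x',y\rangle=\langle x,y'\rangle\text{ for all }(y,y')\in T\}$. The symbol $\dot{+}$ denotes the direct sum of graphs as linear subspaces. A relation $S$ in $\mathfrak H$ is selfadjoint if $S=S^*$, nonnegative if $\langle x',x\rangle\ge0$ for all $(x,x')\in S$; for $S=S^*\ge0$, the operator part is $S_s=PS$ with $P$ the orthogonal projection onto $(\mathrm{mul}\,S)^\perp$, and $S_s^{1/2}$ is its square root. For nonnegative selfadjoint relations $C,D$, $C\ge D$ (i.e. $D\le C$) means $\mathrm{dom}\,C_s^{1/2}\subseteq\mathrm{dom}\,D_s^{1/2}$ and $\|D_s^{1/2}x\|\le\|C_s^{1/2}x\|$ for all $x\in\mathrm{dom}\,C_s^{1/2}$; writing such an inequality includes the assertion that $C$ and $D$ are nonnegative and selfadjoint. *)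

(* Defs.v *)
From HB Require Import structures.
From mathcomp Require Import all_boot all_order all_algebra.
From mathcomp Require Import complex.
From mathcomp Require Import classical_sets reals topology normedtype.

Set Implicit Arguments.
Unset Strict Implicit.
Unset Printing Implicit Defensive.

Import Order.TTheory GRing.Theory Num.Theory.
Import numFieldNormedType.Exports.

Local Open Scope classical_set_scope.
Local Open Scope complex_scope.
Local Open Scope ring_scope.

(* Complex Hilbert spaces over C = R[i]; the inner product is linear in its
   first argument and induces the norm. *)
HB.mixin Record CompleteNormedModule_isHilbert (R : realType) H
    of CompleteNormedModule R[i] H := {
  inner : {dot H for @Num.conj R[i]};
  inner_norm : forall x : H, inner x x = `|x| ^+ 2
}.

#[short(type="hilbertType")]
HB.structure Definition Hilbert (R : realType) :=
  {H of CompleteNormedModule_isHilbert R H & CompleteNormedModule R[i] H}.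

Declare Scope linrel_scope.
Delimit Scope linrel_scope with LR.

(* Relations are identified with their graphs; dom T and ran T are T.`1 and
   T.`2. *)
Section LinearRelations.
Context {R : realType}.
Implicit Types H K L : hilbertType R.

Definition is_linrel H K (T : set (H * K)) : Prop :=
  T 0 /\ forall (a : R[i]) (u v : H * K), T u -> T v -> T (a *: u + v).

Definition lr_ker H K (T : set (H * K)) : set H := [set x | T (x, 0)].

Definition lr_mul H K (T : set (H * K)) : set K := [set y | T (0, y)].

(* The relational product S T: first T, then S. *)
Definition lr_prod H K L (S : set (K * L)) (T : set (H * K)) : set (H * L) :=
  (S \; T)%relation.

Definition lr_scale H K (c : R) (T : set (H * K)) : set (H * K) :=
  [set u | exists2 y, T (u.1, y) & u.2 = c%:C *: y].

Definition adj H K (T : set (H * K)) : set (K * H) :=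
  [set u | forall y y', T (y, y') -> inner u.2 y = inner u.1 y'].

Definition selfadj H (S : set (H * H)) : Prop := S = adj S.

Definition nonneg H (S : set (H * H)) : Prop :=
  forall x x', S (x, x') -> 0 <= inner x' x.

(* B^+(H) *)
Definition bounded_nonneg H (A : set (H * H)) : Prop :=
  [/\ is_linrel A,
      lr_mul A = [set 0],
      A.`1 = setT,
      exists M : R, forall x y, A (x, y) -> `|y| <= M%:C * `|x|
    & selfadj A /\ nonneg A].

Definition sumset (V : lmodType R[i]) (A B : set V) : set V :=
  [set a + b | a in A & b in B].

Definition is_direct_sum (V : lmodType R[i]) (C A B : set V) : Prop :=
  A `&` B = [set 0] /\ C = sumset A B.

Definition ortho H (M : set H) : set H :=
  [set x | forall m, M m -> inner x m = 0].

(* Graph of the orthogonal projection onto the closed subspace M. *)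
Definition orthoproj H (M : set H) : set (H * H) :=
  [set u | M u.2 /\ ortho M (u.1 - u.2)].

Definition op_part H (S : set (H * H)) : set (H * H) :=
  lr_prod (orthoproj (ortho (lr_mul S))) S.

(* Q is a nonnegative selfadjoint operator in the Hilbert space M, a closed
   subspace of H. *)
Definition nonneg_selfadj_op_in H (M : set H) (Q : set (H * H)) : Prop :=
  [/\ Q = adj Q `&` (M `*` M), lr_mul Q = [set 0] & nonneg Q].

(* The square root of S_s, which is a selfadjoint operator in the Hilbert space
   (mul S)^perp when S = S^* >= 0; only meaningful for such S, for which the
   square root exists and is unique. *)
Definition op_part_sqrt H (S : set (H * H)) : set (H * H) :=
  get [set Q | nonneg_selfadj_op_in (ortho (lr_mul S)) Q /\
               lr_prod Q Q = op_part S].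

(* D <= C *)
Definition lr_le H (D C : set (H * H)) : Prop :=
  [/\ selfadj C /\ nonneg C,
      selfadj D /\ nonneg D,
      (op_part_sqrt C).`1 `<=` (op_part_sqrt D).`1
    & forall x c d, op_part_sqrt C (x, c) -> op_part_sqrt D (x, d) ->
        `|d| <= `|c|].

End LinearRelations.

Notation "S ** T" := (lr_prod S T)
  (at level 40, left associativity) : linrel_scope.
Notation "D <=r C" := (lr_le D C) (at level 70) : linrel_scope.

(* Main.v *)
Require Import Defs.
From mathcomp Require Import all_boot all_order all_algebra.
From mathcomp Require Import complex.
From mathcomp Require Import boolp classical_sets reals topology normedtype.
From mathcomp Require Import ring lra.

Set Implicit Arguments.
Unset Strict Implicit.
Unset Printing Implicit Defensive.

Require Import Defs.

(** Throughout, the complex scalars are handled through the real inner product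
    [rip] and the real norm [nm]: a complex-linear condition on a linear
    subspace holds as soon as its real part does, and over the reals all
    estimates are ordered-field arithmetic.

    Put [S := closure B0 ** T]; it coincides with [adj B ** T], hence is
    selfadjoint.

    The inequality [lr_scale eta S <=r adj T ** T] compares forms.  Since the
    domain of [S] is a core of the square root of the operator part of [S]
    ([sqrt_core]), and since a vector lies in the domain of that square root as
    soon as pairing with [S] is bounded by the form of [S]
    ([sqrt_form_dom]), the order [D <=r C] follows from the purely algebraic
    bound [(rip z x)^2 <= rip z u * rip c x] for [(u, z)] in [D] and [(x, c)] in
    [C] ([lr_le_of_form_bound]).

    From a solution [Y] of the inclusion [T `<=` Y ** adj B0], write [G] for the
    inverse of [Y].  For [(x, y)] in [T] and [(u, y')] in [T] with [(y', z)] in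
    [closure B0] one gets [rip z x = rip (G y) y'], so the form of [S] is the
    form of [G] evaluated in the range of [T]; Cauchy-Schwarz for [G] and the
    boundedness of [G] give the form bound, hence the inequality
    ([factor_form_le]).  The displayed identities follow because every product
    involved is symmetric and squeezed between [S] and its adjoint
    ([factor_identities]).

    Conversely, write [Q] for the square root attached to [lr_scale eta S].  The
    inequality says that [y |-> eta^(-1/2) Q x], for [(x, y)] in [T], is a
    bounded operator on the range of [T].  Extending it by continuity, and by
    zero on the orthogonal complement, to [W] and setting [G := adj W ** W]
    yields a bounded nonnegative operator with
    [rip (G y) y' = rip z x] as above, which kills [lr_mul T] and
    [lr_ker (adj T)].  An element [(k, z)] of [B0] differs from such a [(y', z)]
    by an element of [lr_ker (adj B)], which [G] kills too by the hypothesis on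
    kernels; therefore [T `<=` Y ** adj B0] with [Y] the inverse of [G]
    ([form_le_factor]).

    For the adjoint version, [T `<=` Y ** adj B0] is equivalent to
    [closure B0 ** Y `<=` adj T], and the range condition says exactly that the
    first relation reaches every second component of the second one, so that
    only [lr_ker (adj T)] is missing ([adj_direct_sum]).

    The analytic input is one variational argument ([variational_riesz]), which
    yields projections onto graphs and the Riesz representation on subspaces
    that need not be closed, and the square root of a nonnegative selfadjoint
    relation ([sqrt_exists]). *)

Import Order.TTheory GRing.Theory Num.Theory.
Import numFieldNormedType.Exports.

Local Open Scope classical_set_scope.
Local Open Scope complex_scope.
Local Open Scope ring_scope.
Local Open Scope linrel_scope.

(** * The real inner product of a complex Hilbert space *)

Section RealStructure.
Context {R : realType}.
Implicit Types H K : hilbertType R.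

Definition rip H (x y : H) : R := complex.Re (inner x y).
Definition nm H (x : H) : R := complex.Re `|x|.

Lemma normE H (x : H) : `|x| = (nm x)%:C.
Proof.
have x0 := normr_ge0 x; rewrite /nm RRe_real //; exact: ger0_real.
Qed.

Lemma nm_ge0 H (x : H) : 0 <= nm x.
Proof. by have := normr_ge0 x; rewrite normE (lecR 0). Qed.

Lemma nm_eq0 H (x : H) : nm x = 0 -> x = 0.
Proof. by move=> x0; apply/normr0_eq0; rewrite normE x0. Qed.

Lemma nm0 H : nm (0 : H) = 0.
Proof. by rewrite /nm normr0. Qed.

Lemma nmN H (x : H) : nm (- x) = nm x.
Proof. by rewrite /nm normrN. Qed.

Lemma nmB H (x y : H) : nm (x - y) = nm (y - x).
Proof. by rewrite -nmN opprB. Qed.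

Lemma nmD H (x y : H) : nm (x + y) <= nm x + nm y.
Proof. by have := ler_normD x y; rewrite !normE -rmorphD lecR. Qed.

Lemma nm_tri H (z x y : H) : nm (x - y) <= nm (x - z) + nm (z - y).
Proof. by rewrite (le_trans _ (nmD _ _)) // addrA subrK. Qed.

Lemma nmZ H (a : R) (x : H) : nm (a%:C *: x) = `|a| * nm x.
Proof. by rewrite /nm normrZ normc_def /= expr0n addr0 sqrtr_sqr normE -rmorphM. Qed.

Lemma innerDl H (x y z : H) : inner (x + y) z = inner x z + inner y z.
Proof. exact: linearDl. Qed.
Lemma innerDr H (x y z : H) : inner z (x + y) = inner z x + inner z y.
Proof. exact: linearDr. Qed.
Lemma innerZl H a (x z : H) : inner (a *: x) z = a * inner x z.
Proof. exact: linearZl_LR. Qed.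
Lemma innerZr H a (x z : H) : inner z (a *: x) = Num.conj a * inner z x.
Proof. exact: linearZr_LR. Qed.
Lemma innerC H (x y : H) : inner x y = Num.conj (inner y x).
Proof. by rewrite (hermC (inner : {dot H for _})) expr0 mul1r. Qed.

Lemma conjE (a : R[i]) : Num.conj a = complex.Re a -i* complex.Im a.
Proof. by case: a. Qed.

Lemma ripC H (x y : H) : rip x y = rip y x.
Proof. by rewrite /rip innerC conjE. Qed.
Lemma ripDl H (x y z : H) : rip (x + y) z = rip x z + rip y z.
Proof. by rewrite /rip innerDl raddfD. Qed.
Lemma ripDr H (x y z : H) : rip z (x + y) = rip z x + rip z y.
Proof. by rewrite !(ripC z) ripDl. Qed.
Lemma ripZl H (a : R) (x z : H) : rip (a%:C *: x) z = a * rip x z.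
Proof. by rewrite /rip innerZl; case: (inner x z) => b c /=; rewrite mul0r subr0. Qed.
Lemma ripZr H (a : R) (x z : H) : rip z (a%:C *: x) = a * rip z x.
Proof. by rewrite !(ripC z) ripZl. Qed.
Lemma ripNl H (x z : H) : rip (- x) z = - rip x z.
Proof.
have -> : - x = (-1)%:C *: x by rewrite rmorphN rmorph1 scaleN1r.
by rewrite ripZl mulN1r.
Qed.
Lemma ripNr H (x z : H) : rip z (- x) = - rip z x.
Proof. by rewrite !(ripC z) ripNl. Qed.
Lemma rip0l H (z : H) : rip 0 z = 0.
Proof. by rewrite -[0](subrr z) ripDl ripNl subrr. Qed.
Lemma rip0r H (z : H) : rip z 0 = 0.
Proof. by rewrite ripC rip0l. Qed.

Definition ripE := (ripDl, ripDr, ripNl, ripNr, ripZl, ripZr, rip0l, rip0r).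

Lemma rip_nm H (x : H) : rip x x = nm x ^+ 2.
Proof. by rewrite /rip inner_norm normE -rmorphXn. Qed.
Lemma rip_ge0 H (x : H) : 0 <= rip x x.
Proof. by rewrite rip_nm sqr_ge0. Qed.
Lemma rip_eq0 H (x : H) : rip x x = 0 -> x = 0.
Proof. by rewrite rip_nm => /eqP; rewrite sqrf_eq0 => /eqP /nm_eq0. Qed.

(** The imaginary part of the inner product is a real inner product with ['i *: y];
    this is what reduces complex conditions on subspaces to real ones. *)
Lemma innerE H (x y : H) : inner x y = rip x y +i* rip x ('i *: y).
Proof.
rewrite /rip innerZr; case: (inner x y) => a b /=.
by rewrite mul0r mulN1r sub0r opprK.
Qed.

End RealStructure.

(** * Real estimates, completeness and closures *)

Section Analysis.
Context {R : realType}.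
Implicit Types H K : hilbertType R.

Lemma le_eps_mul (a b k : R) : 0 <= k ->
  (forall e, 0 < e -> a <= b + k * e) -> a <= b.
Proof.
move=> k0 h; apply/ler_addgt0Pr => e e0.
have k1 : 0 < k + 1 by lra.
apply: le_trans (h (e / (k + 1)) (divr_gt0 e0 k1)) _.
by rewrite lerD2l mulrA ler_pdivrMr // mulrC ler_pM2l //; lra.
Qed.

(** A real quadratic polynomial without sign change has nonpositive
    discriminant; every Cauchy-Schwarz inequality below is an instance. *)
Lemma discriminant_le (a b c : R) : 0 <= c ->
  (forall t, 0 <= a + 2 * t * b + t ^+ 2 * c) -> b ^+ 2 <= a * c.
Proof.
rewrite le_eqVlt => /orP[/eqP <- h|c0 h].
  rewrite mulr0; have [->|b0] := eqVneq b 0; first by rewrite expr0n.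
  have := h (- (a + 1) / (2 * b)).
  rewrite (_ : a + _ + _ = -1); last by field.
  lra.
have := h (- b / c).
rewrite (_ : a + _ + _ = (a * c - b ^+ 2) / c); last by field; lra.
by rewrite pmulr_lge0 ?invr_gt0 // subr_ge0.
Qed.

Lemma cauchy_schwarz H (x y : H) : rip x y ^+ 2 <= rip x x * rip y y.
Proof.
apply: discriminant_le => [|t]; first exact: rip_ge0.
have := rip_ge0 (x + t%:C *: y); rewrite !ripE (ripC y x); nra.
Qed.

Lemma rip_le H (x y : H) : `|rip x y| <= nm x * nm y.
Proof.
rewrite -(@ler_pXn2r _ 2) ?nnegrE ?mulr_ge0 ?nm_ge0 //.
by rewrite real_normK ?num_real // exprMn -!rip_nm cauchy_schwarz.
Qed.

Lemma ripB_le H (x y z : H) : `|rip x y - rip z y| <= nm (x - z) * nm y.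
Proof. by have := rip_le (x - z) y; rewrite ripDl ripNl. Qed.

(** Completeness without sequences: the images of the sets [P e], as [e] tends
    to 0, form a Cauchy filter base. *)
Lemma cauchy_family_limit H (X : Type) (A : X -> H) (P : R -> X -> Prop) :
    (forall e, 0 < e -> exists x, P e x) ->
    (forall e e' x, e <= e' -> P e x -> P e' x) ->
    (forall e, 0 < e -> exists2 d, 0 < d &
       forall x y, P d x -> P d y -> nm (A x - A y) < e) ->
  exists k, forall e, 0 < e -> exists2 d, 0 < d &
    forall x, P d x -> nm (A x - k) < e.
Proof.
move=> Pex Pmon PA.
pose F : set_system H :=
  [set B | exists2 d, 0 < d & forall x, P d x -> B (A x)].
have FF : ProperFilter F.
  apply: Build_ProperFilter_ex.
    by move=> B [d /Pex[x Px] dB]; exists (A x); apply: dB.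
  split; first by exists 1.
    move=> B C [d d0 dB] [e e0 eC]; exists (Num.min d e).
      by rewrite lt_min d0.
    by move=> x Px; split; [apply: dB|apply: eC];
      apply: Pmon Px; rewrite ge_min lexx ?orbT.
  by move=> B C BC [d d0 dB]; exists d => // x /dB /BC.
have Fc : cauchy F.
  apply: cauchy_exP => e e0.
  have re0 : 0 < complex.Re e by move: e0; rewrite ltcE => /andP[].
  have [d d0 Pd] := PA _ re0; have [x Px] := Pex _ d0.
  exists (A x), d => // y Py; rewrite -ball_normE /ball_ /= normE.
  by rewrite -(RRe_real (gtr0_real e0)) ltcR Pd.
have Fl : F --> lim F by apply: cauchy_cvg.
exists (lim F) => e e0.
have /Fl : nbhs (lim F) (ball (lim F) e%:C).
  by apply: nbhsx_ballx; rewrite ltcR.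
move=> [d d0 dB]; exists d => // x /dB.
by rewrite -ball_normE /ball_ /= normE ltcR nmB.
Qed.

Lemma cauchy_family_limit2 H K (X : Type) (A : X -> H) (B : X -> K)
    (P : R -> X -> Prop) :
    (forall e, 0 < e -> exists x, P e x) ->
    (forall e e' x, e <= e' -> P e x -> P e' x) ->
    (forall e, 0 < e -> exists2 d, 0 < d &
       forall x y, P d x -> P d y -> nm (A x - A y) < e /\ nm (B x - B y) < e) ->
  exists k1 k2, forall d e, 0 < d -> 0 < e -> exists2 x, P d x &
    nm (A x - k1) < e /\ nm (B x - k2) < e.
Proof.
move=> Pex Pmon PAB.
have [|k1 k1P] := @cauchy_family_limit H X A P Pex Pmon.
  by move=> e /PAB[d d0 h]; exists d => // x y Px /(h _ _ Px)[].
have [|k2 k2P] := @cauchy_family_limit K X B P Pex Pmon.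
  by move=> e /PAB[d d0 h]; exists d => // x y Px /(h _ _ Px)[].
exists k1, k2 => d e d0 e0.
have [d1 d10 h1] := k1P e e0; have [d2 d20 h2] := k2P e e0.
have [|x Px] := Pex (Num.min d (Num.min d1 d2)); first by rewrite !lt_min d0 d10.
have Pm e' := fun h => Pmon _ e' x h Px.
exists x; first by apply: Pm; rewrite ge_min lexx.
by split; [apply: h1|apply: h2]; apply: Pm; rewrite !ge_min lexx ?orbT.
Qed.

Lemma closureP H K (D : set (H * K)) u : closure D u <->
  forall e, 0 < e -> exists2 v, D v & nm (v.1 - u.1) < e /\ nm (v.2 - u.2) < e.
Proof.
split=> [Du e e0|h B].
  have /Du[v [Dv [/= b1 b2]]] : nbhs u (ball u e%:C).
    by apply: nbhsx_ballx; rewrite ltcR.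
  exists v => //; split.
    by move: b1; rewrite -ball_normE /ball_ /= normE ltcR nmB.
  by move: b2; rewrite -ball_normE /ball_ /= normE ltcR nmB.
move=> /nbhs_ballP[e /= e0 eB].
have re0 : 0 < complex.Re e by move: e0; rewrite ltcE => /andP[].
have [v Dv [v1 v2]] := h _ re0; exists v; split=> //; apply: eB.
rewrite -(RRe_real (gtr0_real e0)); split.
  by rewrite -ball_normE /ball_ /= normE ltcR nmB.
by rewrite -ball_normE /ball_ /= normE ltcR nmB.
Qed.

Lemma closed_approx H K (D : set (H * K)) x y : closed D ->
  (forall e, 0 < e -> exists2 v, D v & nm (v.1 - x) < e /\ nm (v.2 - y) < e) ->
  D (x, y).
Proof. by move=> Dcl h; apply: Dcl; apply/closureP. Qed.

End Analysis.

(** * A variational form of the Riesz representation *)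

Section Variational.
Context {R : realType}.
Implicit Types H K : hilbertType R.

(** On a product of two spaces this unfolds to [is_linrel], so that the lemmas
    on subspaces apply to graphs. *)
Definition is_subspace (V : lmodType R[i]) (D : set V) : Prop :=
  D 0 /\ forall (a : R[i]) (u v : V), D u -> D v -> D (a *: u + v).

Lemma subspace0 (V : lmodType R[i]) (D : set V) : is_subspace D -> D 0.
Proof. by case. Qed.
Lemma subspaceP (V : lmodType R[i]) (D : set V) a u v :
  is_subspace D -> D u -> D v -> D (a *: u + v).
Proof. by case=> _; apply. Qed.
Lemma subspaceZ (V : lmodType R[i]) (D : set V) a u : is_subspace D -> D u -> D (a *: u).
Proof. by move=> DS Du; rewrite -[_ *: _]addr0; apply: subspaceP => //; exact: subspace0. Qed.
Lemma subspaceD (V : lmodType R[i]) (D : set V) u v :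
  is_subspace D -> D u -> D v -> D (u + v).
Proof. by move=> DS Du Dv; rewrite -[u]scale1r; apply: subspaceP. Qed.
Lemma subspaceN (V : lmodType R[i]) (D : set V) u : is_subspace D -> D u -> D (- u).
Proof. by move=> DS Du; rewrite -scaleN1r; apply: subspaceZ. Qed.
Lemma subspaceB (V : lmodType R[i]) (D : set V) u v :
  is_subspace D -> D u -> D v -> D (u - v).
Proof. by move=> DS Du Dv; apply: subspaceD => //; apply: subspaceN. Qed.

(** Minimize [|A u|^2 + |B u|^2 - 2 f u] over [D].  By the parallelogram law
    minimizing families are Cauchy, and the first variation vanishes at the
    limit.  As [D] may fail to be closed, the limit is only approximated from
    the image of [D]. *)
Lemma variational_riesz H K (X : lmodType R[i]) (A : X -> H) (B : X -> K) (f : X -> R)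
    (D : set X) (c : R) :
    is_subspace D ->
    (forall (t : R) u v, A (t%:C *: u + v) = t%:C *: A u + A v) ->
    (forall (t : R) u v, B (t%:C *: u + v) = t%:C *: B u + B v) ->
    (forall (t : R) u v, f (t%:C *: u + v) = t * f u + f v) ->
    (forall u, D u -> - c <= rip (A u) (A u) + rip (B u) (B u) - 2 * f u) ->
  exists k1 k2,
    (forall e, 0 < e -> exists2 u, D u & nm (A u - k1) < e /\ nm (B u - k2) < e)
    /\ forall u, D u -> f u = rip k1 (A u) + rip k2 (B u).
Proof.
move=> DS AL BL fL lb.
pose E u := rip (A u) (A u) + rip (B u) (B u) - 2 * f u.
pose m := inf (E @` D).
have Einf : has_inf (E @` D).
  split; first by exists (E 0), 0 => //; exact: subspace0.
  by exists (- c) => _ [u Du <-]; apply: lb.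
have mE u : D u -> m <= E u.
  by move=> Du; apply: ge_inf; [case: Einf|exists u].
pose P e u := D u /\ E u < m + e.
have Pex e : 0 < e -> exists u, P e u.
  by move=> e0; have [_ [u Du <-] Eu] := inf_adherent e0 Einf; exists u.
have Pmon e e' u : e <= e' -> P e u -> P e' u.
  by move=> ee' [Du Eu]; split=> //; lra.
have PC d u v : P d u -> P d v ->
    nm (A u - A v) ^+ 2 + nm (B u - B v) ^+ 2 < 4 * d.
  move=> [Du Eu] [Dv Ev].
  (* [E] is compared at the midpoint of [u] and [v]. *)
  have Dw : D (2^-1%:C *: ((-1)%:C *: u + v) + u) by do 2!apply: subspaceP => //.
  have := mE _ Dw; move: Eu Ev; rewrite /E !(AL, BL, fL) -!rip_nm !ripE.
  rewrite (ripC (A v) (A u)) (ripC (B v) (B u)); lra.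
have sq_lt (a e : R) : 0 <= a -> 0 < e -> a ^+ 2 < 4 * (e ^+ 2 / 4) -> a < e.
  move=> a0 e0; rewrite (_ : 4 * _ = e ^+ 2); last by field.
  by rewrite ltr_pXn2r // nnegrE // ltW.
have [|k1 [k2 near]] := @cauchy_family_limit2 R H K X A B P Pex Pmon.
  move=> e e0; exists (e ^+ 2 / 4); first by rewrite divr_gt0 // exprn_gt0.
  move=> u v Pu Pv; have := PC _ _ _ Pu Pv.
  have := sqr_ge0 (nm (A u - A v)); have := sqr_ge0 (nm (B u - B v)).
  by split; apply: sq_lt; rewrite ?nm_ge0 //; lra.
exists k1, k2; split=> [e e0|u Du].
  by have [u [Du _] h] := near e e e0 e0; exists u.
apply/eqP; rewrite -subr_eq0 -normr_le0.
pose q := rip (A u) (A u) + rip (B u) (B u).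
have q0 : 0 <= q by rewrite addr_ge0 ?rip_ge0.
apply: (@le_eps_mul _ _ _ (q + 1 + nm (A u) + nm (B u))).
  by have := nm_ge0 (A u); have := nm_ge0 (B u); lra.
(* The infimum is met up to the square of [e], since the first variation is only
   bounded by the square root of the defect. *)
move=> e e0; have [x [Dx Ex] [xk1 xk2]] := near _ e (exprn_gt0 2 e0) e0.
pose d := rip (A x) (A u) + rip (B x) (B u) - f u.
have dle : d ^+ 2 <= e ^+ 2 * q.
  apply: discriminant_le => // t.
  have := mE _ (subspaceP t%:C DS Du Dx); move: Ex.
  rewrite /E AL BL fL !ripE (ripC (A u) (A x)) (ripC (B u) (B x)) /d /q.
  by move=> h1 h2; lra.
have dle' : `|d| <= e * (q + 1).
  rewrite -(@ler_pXn2r _ 2) ?nnegrE ?mulr_ge0 ?(ltW e0) //; last by lra.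
  rewrite real_normK ?num_real // (le_trans dle) // exprMn.
  by rewrite ler_pM2l ?exprn_gt0 //; nra.
have := ripB_le (A x) (A u) k1; have := ripB_le (B x) (B u) k2.
have := nm_ge0 (A u); have := nm_ge0 (B u).
have {}xk1 := ltW xk1; have {}xk2 := ltW xk2.
move=> b0 a0 hb ha.
have {}ha := le_trans ha (ler_wpM2r a0 xk1).
have {}hb := le_trans hb (ler_wpM2r b0 xk2).
have -> : f u - (rip k1 (A u) + rip k2 (B u)) =
  (rip (A x) (A u) - rip k1 (A u)) + (rip (B x) (B u) - rip k2 (B u)) - d.
  rewrite /d; ring.
apply: le_trans (ler_normB _ _) _; apply: le_trans (lerD (ler_normD _ _) (lexx _)) _.
lra.
Qed.

(** The orthogonal projection onto the closure of a graph, for the Hilbert sum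
    of the two spaces: the norm of the product type is a maximum norm, hence the
    two components are kept apart. *)
Lemma graph_projection H K (T : set (H * K)) a b : is_linrel T ->
  exists x y, closure T (x, y) /\
    forall u v, T (u, v) -> rip (a - x) u + rip (b - y) v = 0.
Proof.
move=> Tl.
have [||||x [y [xy xyE]]] := @variational_riesz H K (H * K)%type fst snd
  (fun u => rip a u.1 + rip b u.2) T (rip a a + rip b b) Tl.
- by [].
- by [].
- by move=> t u v /=; rewrite !ripE; ring.
- move=> [u v] _ /=; have := rip_ge0 (u - a); have := rip_ge0 (v - b).
  rewrite !ripE (ripC a) (ripC b); lra.
exists x, y; split.
  by apply/closureP => e /xy[v Tv h]; exists v.
by move=> u v /xyE /=; rewrite !ripE; lra.
Qed.

(** A bounded functional on the image of [D] under [A] is represented by a vector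
    in the closure of that image: extension and Riesz representation at once. *)
Lemma riesz_extension H (X : lmodType R[i]) (A : X -> H) (f : X -> R) (D : set X) c :
    is_subspace D -> 0 <= c ->
    (forall (t : R) u v, A (t%:C *: u + v) = t%:C *: A u + A v) ->
    (forall (t : R) u v, f (t%:C *: u + v) = t * f u + f v) ->
    (forall u, D u -> f u <= c * nm (A u)) ->
  exists k, [/\ forall e, 0 < e -> exists2 u, D u & nm (A u - k) < e,
    forall u, D u -> f u = rip k (A u) & nm k <= c].
Proof.
move=> DS c0 AL fL fb.
have [||||k [k' [kP kE]]] := @variational_riesz H H X A (fun=> 0) f D (c ^+ 2) DS.
- by [].
- by move=> t _ _; rewrite scaler0 addr0.
- by [].
- move=> u Du; have := fb _ Du; rewrite !ripE rip_nm.
  have := sqr_ge0 (c - nm (A u)); nra.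
exists k; split=> [e /kP[u Du [h _]]|u Du|]; first by exists u.
  by rewrite kE // rip0r addr0.
have [->|k0] := eqVneq (nm k) 0; first by [].
have kp : 0 < nm k by rewrite lt_def k0 nm_ge0.
rewrite -(ler_pM2r kp) -expr2.
apply: (@le_eps_mul _ _ _ (nm k + c)); first by rewrite addr_ge0 ?nm_ge0.
move=> e /kP[u Du [uk _]].
have fu := fb _ Du; rewrite kE // rip0r addr0 in fu.
have := ripB_le k k (A u); rewrite -rip_nm nmB ler_distl => /andP[_].
rewrite (ripC (A u)).
have := nm_tri k (A u) 0; rewrite !subr0 => t1 t2.
have c1 : c * nm (A u) <= c * (nm k + e) by apply: ler_wpM2l => //; lra.
have c2 : nm (A u - k) * nm k <= e * nm k by apply: ler_wpM2r; rewrite ?nm_ge0 ?ltW.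
lra.
Qed.

End Variational.

(** * Adjoints, orthogonal complements and selfadjoint relations *)

Section Relations.
Context {R : realType}.
Implicit Types H K L : hilbertType R.

Lemma ortho_ripP H (M : set H) x : is_subspace M ->
  ortho M x <-> forall m, M m -> rip x m = 0.
Proof.
move=> Ms; split=> [h m /h|h m Mm]; first by rewrite /rip => ->.
by rewrite innerE h // h //; apply: subspaceZ.
Qed.

Lemma ortho_subspace H (M : set H) : is_subspace (ortho M).
Proof.
split=> [m _|a u v hu hv m Mm]; first by rewrite innerE !rip0l.
by rewrite innerDl innerZl hu // hv // mulr0 addr0.
Qed.

Lemma ortho_approx H (M : set H) x : is_subspace M ->
  (forall e, 0 < e -> exists2 m, ortho M m & nm (m - x) < e) -> ortho M x.
Proof.
move=> Ms h; apply/ortho_ripP => // m Mm.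
apply/eqP; rewrite -normr_le0.
apply: (@le_eps_mul _ _ _ (nm m)); first exact: nm_ge0.
move=> e /h[k /(ortho_ripP _ Ms) kM kx].
have := ripB_le x m k; rewrite kM // subr0 add0r nmB mulrC => /le_trans; apply.
by rewrite ler_wpM2l ?nm_ge0 ?ltW.
Qed.

Lemma ortho2_approx H (M : set H) x : is_subspace M ->
  (forall e, 0 < e -> exists2 m, M m & nm (m - x) < e) -> ortho (ortho M) x.
Proof.
move=> Ms h; apply: ortho_approx; first exact: ortho_subspace.
move=> e /h[m Mm mx]; exists m => // n nM.
by rewrite innerC nM // conjE /= oppr0.
Qed.

Lemma ortho_proj H (M : set H) z : is_subspace M ->
  exists2 k, (forall e, 0 < e -> exists2 m, M m & nm (m - k) < e)
           & ortho M (z - k).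
Proof.
move=> Ms.
have [|||k [kM kE _]] := @riesz_extension R H H id (rip z) M (nm z) Ms (nm_ge0 z).
- by [].
- by move=> t u v; rewrite !ripE.
- by move=> u _; apply: le_trans (rip_le _ _); exact: ler_norm.
by exists k => //; apply/ortho_ripP => // m Mm; rewrite !ripE kE // subrr.
Qed.

Lemma ortho_orthoproj H (N : set H) z : is_subspace N ->
  exists2 k, ortho N k & ortho (ortho N) (z - k).
Proof.
move=> Ns; have [k kM zk] := ortho_proj z (ortho_subspace N).
by exists k => //; apply: ortho_approx.
Qed.

Lemma adj_lin H K (T : set (H * K)) : is_linrel (adj T).
Proof.
split=> [y y' _|a [u u'] [v v'] hu hv y y' Ty] /=.
  by rewrite !innerE !rip0l.
by rewrite !innerDl !innerZl (hu _ _ Ty) (hv _ _ Ty).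
Qed.

Lemma adjP H K (T : set (H * K)) x x' : is_linrel T ->
  adj T (x, x') <-> forall y y', T (y, y') -> rip x' y = rip x y'.
Proof.
move=> Tl; split=> [h y y' /h/=|h y y' Ty /=]; first by rewrite /rip => ->.
rewrite !innerE (h _ _ Ty); congr (_ +i* _).
by apply: h; have /= := subspaceZ 'i Tl Ty.
Qed.

Lemma adj_closed H K (T : set (H * K)) : is_linrel T -> closed (adj T).
Proof.
move=> Tl [x x'] /closureP xx; apply/adjP => // y y' Ty.
apply/eqP; rewrite -subr_eq0 -normr_le0.
apply: (@le_eps_mul _ _ _ (nm y + nm y')); first by rewrite addr_ge0 ?nm_ge0.
move=> e /xx[[v v'] /(adjP _ _ Tl) vT [/= v1 v2]].
have -> : rip x' y - rip x y' = (rip v y' - rip x y') - (rip v' y - rip x' y).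
  by rewrite (vT _ _ Ty); ring.
apply: le_trans (ler_normB _ _) _.
apply: le_trans (lerD (ripB_le _ _ _) (ripB_le _ _ _)) _.
have := ler_wpM2r (nm_ge0 y) (ltW v2); have := ler_wpM2r (nm_ge0 y') (ltW v1).
lra.
Qed.

Lemma sub_adj_adj H K (T : set (H * K)) : T `<=` adj (adj T).
Proof. by move=> [x y] Txy k h /= kh; rewrite innerC -(kh _ _ Txy) -innerC. Qed.

Lemma closure_sub_adj_adj H K (T : set (H * K)) : closure T `<=` adj (adj T).
Proof.
rewrite [X in _ `<=` X](closure_id _).1; last exact/adj_closed/adj_lin.
by apply: closure_subset; exact: sub_adj_adj.
Qed.

(** The difference between an element of the double adjoint and its projection
    onto [T] is orthogonal to [T]; such a pair, rotated, lies in the adjoint, and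
    pairing it with the difference shows that the latter vanishes. *)
Lemma adj_adj H K (T : set (H * K)) : is_linrel T -> closed T -> adj (adj T) = T.
Proof.
move=> Tl Tc; apply/seteqP; split=> [[a b] ab|]; last exact: sub_adj_adj.
have [x [y [/Tc xy xyE]]] := graph_projection a b Tl.
have /(adjP _ _ (adj_lin T)) hd : adj (adj T) (a - x, b - y).
  by have := subspaceB (adj_lin (adj T)) ab (sub_adj_adj xy).
have := hd (- (b - y)) (a - x); rewrite ripNr => h.
have {}h : rip (a - x) (a - x) = - rip (b - y) (b - y).
  rewrite -h //; apply/adjP => // u v /xyE; rewrite ripNl; lra.
have := rip_ge0 (a - x); have := rip_ge0 (b - y) => p1 p2.
have /rip_eq0/eqP : rip (a - x) (a - x) = 0 by lra.
have /rip_eq0/eqP : rip (b - y) (b - y) = 0 by lra.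
by rewrite !subr_eq0 => /eqP -> /eqP ->.
Qed.

Lemma adj_prod H K L (S : set (K * L)) (T : set (H * K)) :
  adj T ** adj S `<=` adj (S ** T).
Proof.
by move=> [l h] [k lk kh] x z [y Ty Sy] /=; rewrite (kh _ _ Ty) (lk _ _ Sy).
Qed.

Lemma adj_mono H K (S T : set (H * K)) : S `<=` T -> adj T `<=` adj S.
Proof. by move=> ST [x x'] h y y' /ST; apply: h. Qed.

Lemma prod_lin H K L (S : set (K * L)) (T : set (H * K)) :
  is_linrel S -> is_linrel T -> is_linrel (S ** T).
Proof.
move=> Sl Tl; split; first by exists 0; [exact: subspace0 Tl|exact: subspace0 Sl].
move=> a [x z] [x' z'] [y Ty Sy] [y' Ty' Sy'] /=.
by exists (a *: y + y'); [exact: (subspaceP a Tl Ty Ty')|exact: (subspaceP a Sl Sy Sy')].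
Qed.

Lemma mul_subspace H K (T : set (H * K)) : is_linrel T -> is_subspace (lr_mul T).
Proof.
move=> Tl; split; first exact: subspace0 Tl.
move=> a u v Tu Tv; have : T (a *: 0 + 0, a *: u + v) := subspaceP a Tl Tu Tv.
by rewrite scaler0 addr0.
Qed.

Lemma dom_subspace H K (T : set (H * K)) : is_linrel T -> is_subspace T.`1.
Proof.
move=> Tl; split; first by exists 0; exact: subspace0 Tl.
by move=> a u v [u' Tu] [v' Tv]; exists (a *: u' + v'); exact: (subspaceP a Tl Tu Tv).
Qed.

Lemma ran_subspace H K (T : set (H * K)) : is_linrel T -> is_subspace T.`2.
Proof.
move=> Tl; split; first by exists 0; exact: subspace0 Tl.
by move=> a u v [u' Tu] [v' Tv]; exists (a *: u' + v'); exact: (subspaceP a Tl Tu Tv).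
Qed.

Lemma mul_adj H K (T : set (H * K)) : lr_mul (adj T) = ortho T.`1.
Proof.
apply/seteqP; split=> [h h0 x [y Txy]|h h0 x y Txy] /=.
  by rewrite (h0 _ _ Txy) innerE !rip0l.
by rewrite h0 ?innerE ?rip0l //; exists y.
Qed.

Lemma ker_adj H K (T : set (H * K)) : lr_ker (adj T) = ortho T.`2.
Proof.
apply/seteqP; split=> [h h0 x [y Txy]|h h0 x y Txy] /=.
  by have /= <- := h0 _ _ Txy; rewrite innerE !rip0l.
by rewrite h0 ?innerE ?rip0l //; exists x.
Qed.

(** Although [L] may be far from densely defined, its adjoint is everywhere
    defined, and has values in the closure of the domain of [L]. *)
Lemma adj_total_of_bounded H K (L : set (K * H)) c : is_linrel L -> 0 <= c ->
    (forall y w, L (y, w) -> nm w <= c * nm y) ->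
  forall h, exists k, [/\ ortho (ortho L.`1) k, adj L (h, k) & nm k <= c * nm h].
Proof.
move=> Ll c0 Lb h.
have [|||k [kL kE kb]] := @riesz_extension R K (K * H)%type fst (fun u => rip h u.2)
   L (c * nm h) Ll (mulr_ge0 c0 (nm_ge0 h)).
- by [].
- by move=> t u v /=; rewrite !ripE.
- move=> [y w] /Lb /= yw.
  apply: (le_trans (ler_norm _)); apply: (le_trans (rip_le _ _)).
  have := ler_wpM2l (nm_ge0 h) yw; lra.
exists k; split=> //.
  apply: ortho2_approx; first exact: dom_subspace.
  by move=> e /kL[[y w] yw yk]; exists y => //; exists w.
by apply/adjP => // y w /kE /= ->.
Qed.

Lemma rip_sym H (S : set (H * H)) x x' y y' : S `<=` adj S ->
  S (x, x') -> S (y, y') -> rip x' y = rip x y'.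
Proof. by move=> Ss /Ss h /h /=; rewrite /rip => ->. Qed.

(** On a symmetric relation the numbers [inner x' x] are real, so the order of
    the complex numbers reduces to that of their real parts. *)
Lemma nonnegP H (S : set (H * H)) : S `<=` adj S ->
  nonneg S <-> forall x x', S (x, x') -> 0 <= rip x' x.
Proof.
move=> Ss; split=> h x x' xx; first by have := h _ _ xx; rewrite lecE => /andP[].
have /= hC := Ss _ xx _ _ xx; have hc := innerC x x'.
rewrite lecE; apply/andP; split; last exact: h _ _ xx.
move: hc; rewrite -hC => /(congr1 (@complex.Im R)).
by rewrite conjE /= => ?; apply/eqP; lra.
Qed.

(** The von Neumann criterion: subtracting from an element of the adjoint the
    element of [S] with the same image under [1 + S] leaves a pair [(d, - d)]
    whose [d] is orthogonal to the range of [1 + S]. *)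
Lemma selfadj_of_surj H (S : set (H * H)) : is_linrel S -> S `<=` adj S ->
  (forall a, exists x z, S (x, z) /\ x + z = a) -> selfadj S.
Proof.
move=> Sl Ss Ssurj; apply/seteqP; split=> // -[x z] xz.
have [x1 [z1 [S1 E1]]] := Ssurj (x + z).
have hd : adj S (x - x1, z - z1) by have := subspaceB (adj_lin S) xz (Ss _ S1).
have zE : z - z1 = - (x - x1).
  by apply/eqP; rewrite -addr_eq0 addrACA -opprD (addrC z1) E1 (addrC z) subrr.
have [u [v [uv uvE]]] := Ssurj (x - x1).
have /adjP /(_ _ _ uv) := hd; rewrite zE ripNl => /(_ Sl) h.
have /rip_eq0/eqP : rip (x - x1) (x - x1) = 0.
  by rewrite -{2}uvE ripDr; lra.
rewrite subr_eq0 => /eqP xE; move: zE; rewrite xE subrr oppr0 => /eqP.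
by rewrite subr_eq0 => /eqP ->.
Qed.

(** Projecting [(a, 0)] onto the graph of [T] solves
    [a = x + z] with [(x, z)] in [adj T ** T]. *)
Lemma adj_prod_selfadj H K (T : set (H * K)) : is_linrel T -> closed T ->
  selfadj (adj T ** T).
Proof.
move=> Tl Tc; apply: selfadj_of_surj.
- exact: prod_lin (adj_lin T) Tl.
- by apply: subset_trans (@adj_prod _ _ _ _ _); rewrite adj_adj.
- move=> a; have [x [y [/Tc xy E]]] := graph_projection a 0 Tl.
  exists x, (a - x); split; last by rewrite addrC subrK.
  exists y => //; apply/adjP => // u v /E; rewrite sub0r ripNl; lra.
Qed.

Lemma adj_prod_nonneg H K (T : set (H * K)) : nonneg (adj T ** T).
Proof.
move=> x z [y Txy /(_ _ _ Txy) /= ->].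
by rewrite inner_norm exprn_ge0 ?normr_ge0.
Qed.

(** The range of [1 + S] is dense because a vector orthogonal to it gives
    [(d, - d)] in [S], which contradicts nonnegativity unless [d = 0]; it is
    closed because [|x|^2 + |z|^2 <= |x + z|^2] on [S]. *)
Lemma add_id_surj H (S : set (H * H)) : selfadj S -> nonneg S ->
  forall a, exists x z, S (x, z) /\ x + z = a.
Proof.
move=> Sa Sn a.
have Sl : is_linrel S by rewrite Sa; exact: adj_lin.
have Ss : S `<=` adj S by rewrite -Sa.
have Sc : closed S by rewrite Sa; exact: adj_closed.
have {}Sn := (nonnegP Ss).1 Sn.
have le_add x z : S (x, z) -> nm x ^+ 2 + nm z ^+ 2 <= nm (x + z) ^+ 2.
  by move=> /Sn; rewrite -!rip_nm !ripE (ripC x z); lra.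
have le1 x z : S (x, z) -> nm x <= nm (x + z).
  move=> /le_add h; rewrite -(@ler_pXn2r _ 2) ?nnegrE ?nm_ge0 //.
  by have := sqr_ge0 (nm z); lra.
have le2 x z : S (x, z) -> nm z <= nm (x + z).
  move=> /le_add h; rewrite -(@ler_pXn2r _ 2) ?nnegrE ?nm_ge0 //.
  by have := sqr_ge0 (nm x); lra.
pose P e (u : H * H) := S u /\ nm (u.1 + u.2 - a) < e.
have [|||k [kP kE _]] := @riesz_extension R H (H * H)%type (fun u => u.1 + u.2)
   (fun u => rip a (u.1 + u.2)) S (nm a) Sl (nm_ge0 a).
- by move=> t u v /=; rewrite scalerDr addrACA.
- by move=> t u v /=; rewrite !ripE; ring.
- by move=> u _; apply: le_trans (rip_le _ _); exact: ler_norm.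
have ka : k = a.
  have : S (a - k, - (a - k)).
    rewrite Sa; apply/adjP => // y y' /kE /=; rewrite !ripE; lra.
  move=> /Sn; rewrite ripNl oppr_ge0 => h.
  have /rip_eq0/eqP : rip (a - k) (a - k) = 0.
    by apply/le_anti; rewrite h rip_ge0.
  by rewrite subr_eq0 => /eqP ->.
have Pex e : 0 < e -> exists u, P e u.
  by move=> /kP[u Su uk]; exists u; split=> //; rewrite -ka.
have Pmon e e' u : e <= e' -> P e u -> P e' u.
  by move=> ee' [Du Eu]; split=> //; lra.
have PC d u v : P d u -> P d v ->
    nm (u.1 - v.1) < d + d /\ nm (u.2 - v.2) < d + d.
  move=> [Su Eu] [Sv Ev]; have Suv := subspaceB Sl Su Sv.
  have E : nm ((u - v).1 + (u - v).2) < d + d.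
    have /= := nm_tri a (u.1 + u.2) (v.1 + v.2).
    rewrite (nmB a) opprD addrACA; lra.
  move: E Suv; case: u {Su Eu} => u1 u2; case: v {Sv Ev} => v1 v2 /= E Suv.
  by have := le1 _ _ Suv; have := le2 _ _ Suv; lra.
have [|x [z near]] := @cauchy_family_limit2 R H H _ fst snd P Pex Pmon.
  move=> e e0; exists (e / 2); first lra.
  by move=> u v /PC h /h; rewrite -splitr.
exists x, z; split.
  by apply: closed_approx => // e e0; have [u [Su _] h] := near e e e0 e0; exists u.
apply/eqP; rewrite -subr_eq0; apply/eqP/nm_eq0/le_anti/andP; split; last exact: nm_ge0.
apply: (@le_eps_mul _ _ _ 3) => // e e0.
have [[u v] [_ /= h] [/= h1 h2]] := near e e e0 e0.
have := nm_tri (u + v) (x + z) a; rewrite (nmB (x + z) (u + v)) opprD addrACA.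
have := nmD (u - x) (v - z); lra.
Qed.

End Relations.

(** * Square roots of bounded nonnegative operators *)

Section SquareRoot.
Context {R : realType} {H : hilbertType R}.
Implicit Types f g : H -> H.

Definition symm_op f := forall x y, inner (f x) y = inner x (f y).

Lemma symm_rip f x y : symm_op f -> rip (f x) y = rip x (f y).
Proof. by rewrite /rip => ->. Qed.

Lemma inner_inj (x y : H) : (forall z, inner x z = inner y z) -> x = y.
Proof.
move=> h; apply/eqP; rewrite -subr_eq0; apply/eqP/rip_eq0.
by rewrite ripDl ripNl /rip h subrr.
Qed.

(** Symmetry of an everywhere defined map already forces linearity. *)
Lemma symm_opP f a x y : symm_op f -> f (a *: x + y) = a *: f x + f y.
Proof. by move=> fs; apply: inner_inj => z; rewrite fs !innerDl !innerZl !fs. Qed.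
Lemma symm_op0 f : symm_op f -> f 0 = 0.
Proof.
move=> fs; apply: inner_inj => z.
by rewrite fs !innerE !rip0l.
Qed.
Lemma symm_opD f x y : symm_op f -> f (x + y) = f x + f y.
Proof. by move=> fs; have := symm_opP 1 x y fs; rewrite !scale1r. Qed.
Lemma symm_opZ f a x : symm_op f -> f (a *: x) = a *: f x.
Proof. by move=> fs; have := symm_opP a x 0 fs; rewrite (symm_op0 fs) !addr0. Qed.
Lemma symm_opB f x y : symm_op f -> f (x - y) = f x - f y.
Proof. by move=> fs; rewrite symm_opD // -scaleN1r symm_opZ // scaleN1r. Qed.

Lemma innerNl (x z : H) : inner (- x) z = - inner x z.
Proof. exact: linearNl. Qed.
Lemma innerNr (x z : H) : inner z (- x) = - inner z x.
Proof. exact: linearNr. Qed.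

Lemma symm_id_sub f : symm_op f -> symm_op (fun x => x - f x).
Proof. by move=> fs x y; rewrite innerDl innerDr innerNl innerNr fs. Qed.

(** The sequence [sqrt_iter] run on the scalar 1; it controls the increments of
    the iteration on every contraction. *)
Fixpoint majorant (n : nat) : R :=
  if n is m.+1 then (1 + majorant m ^+ 2) / 2 else 0.

(** The square root of [1 - f] is [1 - Y] with [Y = (f + Y^2) / 2]; this is the
    fixed-point iteration for [Y], started at 0. *)
Fixpoint sqrt_iter f (n : nat) (x : H) : H :=
  if n is m.+1 then (2^-1)%:C *: (f x + sqrt_iter f m (sqrt_iter f m x)) else 0.

Lemma majorant_01 n : 0 <= majorant n <= 1.
Proof.
elim: n => [|n /andP[t0 t1]] /=; first by rewrite lexx ler01.
by apply/andP; split; nra.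
Qed.

Lemma majorant_leS n : majorant n <= majorant n.+1.
Proof. by rewrite /=; have := sqr_ge0 (1 - majorant n); nra. Qed.

Lemma majorant_le n m : (n <= m)%N -> majorant n <= majorant m.
Proof.
by apply: (@homo_leq _ majorant <=%R) => [a|b a c|k];
  [exact: lexx|exact: le_trans|exact: majorant_leS].
Qed.

Context (B : H -> H) (Bs : symm_op B) (Bc : forall x, nm (B x) <= nm x).
Let X := sqrt_iter B.

Lemma sqrt_iter_symm n : symm_op (X n).
Proof.
elim: n => [|n IH] x y /=; first by rewrite [RHS]innerC !innerE !rip0l conjE /= oppr0.
rewrite innerZl innerZr !innerDl !innerDr Bs !IH conjE /=; congr (_ * _).
by rewrite oppr0.
Qed.

Lemma half_ge0 : 0 <= 2^-1 :> R. Proof. by rewrite invr_ge0. Qed.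

Lemma sqrt_iter_le n x : nm (X n x) <= majorant n * nm x.
Proof.
elim: n x => [|n IH] x /=; first by rewrite nm0 mul0r.
rewrite nmZ ger0_norm ?half_ge0 //.
have := nmD (B x) (X n (X n x)); have := Bc x; have := IH (X n x).
have /andP[t0 _] := majorant_01 n.
have := ler_wpM2l t0 (IH x); rewrite -/X; lra.
Qed.

(** [X_(n+2) - X_(n+1)] is half of [X_(n+1)^2 - X_n^2], which factors as
    [X_(n+1) (X_(n+1) - X_n) + (X_(n+1) - X_n) X_n]; the scalar increments
    satisfy the same recursion. *)
Lemma sqrt_iter_leS n x : nm (X n.+1 x - X n x) <= (majorant n.+1 - majorant n) * nm x.
Proof.
elim: n x => [|n IH] x.
  have /= := sqrt_iter_le 1 x.
  by rewrite !subr0.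
have -> : X n.+2 x - X n.+1 x =
   (2^-1)%:C *: (X n.+1 (X n.+1 x - X n x) + (X n.+1 (X n x) - X n (X n x))).
  rewrite (symm_opB _ _ (sqrt_iter_symm n.+1)).
  by rewrite addrA subrK [LHS]/= -scalerBr opprD addrACA subrr add0r.
rewrite nmZ ger0_norm ?half_ge0 //.
apply: le_trans (ler_wpM2l half_ge0 (nmD _ _)) _.
have h1 := le_trans (sqrt_iter_le n.+1 _) (ler_wpM2l (proj1 (andP (majorant_01 n.+1))) (IH x)).
have incr0 : 0 <= majorant n.+1 - majorant n by rewrite subr_ge0 majorant_leS.
have h2 := le_trans (IH (X n x)) (ler_wpM2l incr0 (sqrt_iter_le n x)).
have -> : majorant n.+2 - majorant n.+1 = (majorant n.+1 ^+ 2 - majorant n ^+ 2) / 2.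
  have E2 : majorant n.+2 = (1 + majorant n.+1 ^+ 2) / 2 by [].
  have E1 : majorant n.+1 = (1 + majorant n ^+ 2) / 2 by [].
  by rewrite E2 {2}E1; field.
lra.
Qed.

Lemma sqrt_iter_leD n m x : (n <= m)%N ->
  nm (X m x - X n x) <= (majorant m - majorant n) * nm x.
Proof.
move=> /subnK <-; elim: (m - n)%N => [|k IH].
  by rewrite add0n !subrr nm0 mul0r.
rewrite addSn; have := nm_tri (X (k + n)%N x) (X (k + n).+1 x) (X n x).
have := sqrt_iter_leS (k + n)%N x; move: IH; lra.
Qed.

Let tau : R := sup (range majorant).

Lemma majorant_sup : has_sup (range majorant).
Proof.
split; first by exists (majorant 0), 0%N.
by exists 1 => _ [n _ <-]; have /andP[] := majorant_01 n.
Qed.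

Lemma majorant_le_sup n : majorant n <= tau.
Proof. by apply: ub_le_sup; [case: majorant_sup|exists n]. Qed.

Lemma majorant_near_sup e : 0 < e -> exists n, tau - majorant n < e.
Proof.
move=> e0; have [_ [n _ <-] ?] := sup_adherent e0 majorant_sup; exists n.
by rewrite /tau; lra.
Qed.

Lemma sqrt_iter_lim x : exists k, forall n, nm (X n x - k) <= (tau - majorant n) * nm x.
Proof.
have x0 := nm_ge0 x.
have [|||k kP] := @cauchy_family_limit R H nat (fun n => X n x)
   (fun e n => tau - majorant n < e).
- exact: majorant_near_sup.
- by move=> e e' n ee /lt_le_trans; apply.
- move=> e e0; have x1 : 0 < nm x + 1 by lra.
  exists (e / (nm x + 1)); first exact: divr_gt0.
  have main n m : (n <= m)%N -> tau - majorant n < e / (nm x + 1) ->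
      nm (X m x - X n x) < e.
    move=> /sqrt_iter_leD h1; rewrite ltr_pdivlMr // => h2.
    have := majorant_le_sup n; have := majorant_le_sup m; have := h1 x; nra.
  move=> n m Pn Pm; have [nm_|/ltnW mn] := leqP n m; last exact: main.
  by rewrite nmB; exact: main.
exists k => n; apply: (@le_eps_mul _ _ _ 1) => // e e0; rewrite mul1r.
have [d d0 dk] := kP _ e0; have [m tm] := majorant_near_sup d0.
have tm' : tau - majorant (maxn n m) < d.
  by apply: le_lt_trans tm; rewrite lerD2l lerN2 majorant_le ?leq_maxr.
have h1 := dk _ tm'; have h2 := sqrt_iter_leD x (leq_maxl n m).
have h3 := nm_tri (X (maxn n m) x) (X n x) k; rewrite nmB in h2.
have h4 : (majorant (maxn n m) - majorant n) * nm x <= (tau - majorant n) * nm x.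
  by apply: ler_wpM2r => //; rewrite lerD2r majorant_le_sup.
lra.
Qed.

(** The commutation clause holds along the iteration and passes to the limit; it
    lets the square roots of commuting operators commute. *)
Lemma contraction_fixpoint : exists Y : H -> H, [/\ symm_op Y,
    forall x, nm (Y x) <= nm x, forall x, Y x + Y x = B x + Y (Y x) &
    forall C c, symm_op C -> 0 <= c -> (forall x, nm (C x) <= c * nm x) ->
      (forall x, C (B x) = B (C x)) -> forall x, C (Y x) = Y (C x)].
Proof.
have [Y YP] := choice sqrt_iter_lim; exists Y.
have approx e : 0 < e -> exists n, (forall x, nm (X n x - Y x) <= e * nm x)
     /\ (forall x, nm (X n.+1 x - Y x) <= e * nm x).
  move=> /majorant_near_sup[n tn]; exists n; split=> x; apply: le_trans (YP _ _) _;
    apply: ler_wpM2r; rewrite ?nm_ge0 //; have := majorant_leS n; lra.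
have Xc n x : nm (X n x) <= nm x.
  apply: le_trans (sqrt_iter_le _ _) _; have /andP[_ t1] := majorant_01 n.
  by have := ler_wpM2r (nm_ge0 x) t1; rewrite mul1r.
have Yc x : nm (Y x) <= nm x.
  apply: (@le_eps_mul _ _ _ (nm x)); first exact: nm_ge0.
  move=> e /approx[n [/(_ x) h _]]; have := nm_tri (X n x) (Y x) 0.
  rewrite !subr0 (nmB (Y x)); have := Xc n x; lra.
have lim0 (z : H) (k : R) : 0 <= k -> (forall e, 0 < e -> nm z <= k * e) -> z = 0.
  move=> k0 h; apply/nm_eq0/le_anti; rewrite nm_ge0 andbT.
  by apply: (@le_eps_mul _ _ _ k) => // e /h; rewrite add0r.
have Ysym x w x' y : (forall n, rip (X n x) w = rip x' (X n y)) ->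
    rip (Y x) w = rip x' (Y y).
  move=> h; apply/eqP; rewrite -subr_eq0 -normr_le0.
  apply: (@le_eps_mul _ _ _ (nm x * nm w + nm y * nm x')).
    by rewrite addr_ge0 // mulr_ge0 ?nm_ge0.
  move=> e /approx[n [hn _]].
  have -> : rip (Y x) w - rip x' (Y y) =
     (rip (X n y) x' - rip (Y y) x') - (rip (X n x) w - rip (Y x) w).
    by rewrite h (ripC x') (ripC x'); ring.
  apply: le_trans (ler_normB _ _) _.
  apply: le_trans (lerD (ripB_le _ _ _) (ripB_le _ _ _)) _.
  have := ler_wpM2r (nm_ge0 x') (hn y); have := ler_wpM2r (nm_ge0 w) (hn x).
  lra.
split=> //.
- have iE (u v : H) : rip u ('i *: v) = - rip ('i *: u) v.
    rewrite /rip innerZl innerZr; case: (inner u v) => a b /=; ring.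
  move=> x y; rewrite !innerE; congr (_ +i* _).
    apply: (Ysym x y x y) => n; apply: symm_rip; exact: sqrt_iter_symm.
  rewrite [RHS]iE -ripNl; apply: (Ysym x _ _ y) => n; rewrite ripNl -iE.
  by rewrite (symm_rip _ _ (sqrt_iter_symm n)) (symm_opZ _ _ (sqrt_iter_symm n)).
- move=> x; apply/eqP; rewrite -subr_eq0; apply/eqP.
  apply: (lim0 _ (4 * nm x)) => [|e e0]; first by rewrite mulr_ge0 ?nm_ge0.
  have [n [h1 h2]] := approx _ e0.
  have XE : X n.+1 x + X n.+1 x = B x + X n (X n x).
    rewrite /= -scalerDl -rmorphD (_ : 2^-1 + 2^-1 = 1) ?scale1r //; lra.
  have -> : Y x + Y x - (B x + Y (Y x)) = (Y x - X n.+1 x) + (Y x - X n.+1 x)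
     + (X n (X n x - Y x) + (X n (Y x) - Y (Y x))).
    rewrite (symm_opB _ _ (sqrt_iter_symm n)) [X in _ = X + _]addrACA -opprD XE.
    rewrite [X in _ = _ + X]addrA subrK !opprD -!addrA; congr (_ + (_ + (_ + _))).
    by rewrite addKr.
  have := nmD (Y x - X n.+1 x + (Y x - X n.+1 x))
    (X n (X n x - Y x) + (X n (Y x) - Y (Y x))).
  have := nmD (Y x - X n.+1 x) (Y x - X n.+1 x).
  have := nmD (X n (X n x - Y x)) (X n (Y x) - Y (Y x)).
  have := Xc n (X n x - Y x); have := h1 (Y x); have := h1 x; have := h2 x.
  rewrite (nmB (Y x) (X n.+1 x)).
  have := ler_wpM2l (ltW e0) (Yc x); lra.
- move=> C c Cs c0 Cc CB x; apply/eqP; rewrite -subr_eq0; apply/eqP.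
  have CX n z : C (X n z) = X n (C z).
    elim: n z => [|n IH] z /=; first exact: symm_op0.
    by rewrite symm_opZ // symm_opD // CB !IH.
  apply: (lim0 _ (2 * c * nm x)) => [|e e0]; first by rewrite !mulr_ge0 ?nm_ge0.
  have [n [hn _]] := approx _ e0.
  have -> : C (Y x) - Y (C x) = (X n (C x) - Y (C x)) - C (X n x - Y x).
    by rewrite (symm_opB _ _ Cs) CX opprB [RHS]addrC addrA subrK.
  apply: le_trans (nmD _ _) _; rewrite nmN.
  have := le_trans (Cc (X n x - Y x)) (ler_wpM2l c0 (hn x)).
  have := le_trans (hn (C x)) (ler_wpM2l (ltW e0) (Cc x)).
  lra.
Qed.

End SquareRoot.

(** * Existence of the square root of a selfadjoint relation *)

Section OperatorPart.
Context {R : realType} {H : hilbertType R}.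
Implicit Types f g : H -> H.

Lemma inner0r (x : H) : inner x 0 = 0.
Proof. exact: linear0r. Qed.

Lemma operator_sqrt (A : H -> H) : symm_op A -> (forall x, nm (x - A x) <= nm x) ->
  exists P : H -> H, [/\ symm_op P, forall x, nm (x - P x) <= nm x,
    forall x, P (P x) = A x &
    forall C c, symm_op C -> 0 <= c -> (forall x, nm (C x) <= c * nm x) ->
      (forall x, C (A x) = A (C x)) -> forall x, C (P x) = P (C x)].
Proof.
move=> As Ac; have [Y [Ys Yc YE YC]] := contraction_fixpoint (symm_id_sub As) Ac.
exists (fun x => x - Y x); split=> [|x|x|C c Cs c0 Cc CA x].
- exact: symm_id_sub.
- by rewrite subKr.
- rewrite (symm_opB _ _ Ys) opprB addrACA -opprD YE opprD addrACA subrr addr0.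
  exact: subKr.
- rewrite (symm_opB _ _ Cs) (YC C c) // => y.
  by rewrite (symm_opB _ _ Cs) CA.
Qed.

(** With [rs] the resolvent at [-1], [S] is the set of pairs
    [(rs a, a - rs a)].  Take commuting nonnegative roots [P] of [rs] and [N] of
    [1 - rs].  The pairs [(P a, N a)], for [a] in the orthogonal complement of
    the multivalued part, form the graph of the square root: because
    [P^2 + N^2 = 1], a pair [(x, x')] with [P x' = N x] is the image of
    [a = P x + N x'], and composing the relation with itself gives
    [(P^2 a, N^2 a)]. *)
Lemma sqrt_exists (S : set (H * H)) : selfadj S -> nonneg S ->
  exists Q, nonneg_selfadj_op_in (ortho (lr_mul S)) Q /\ Q ** Q = op_part S.
Proof.
move=> Sa Sn.
have Sl : is_linrel S by rewrite Sa; exact: adj_lin.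
have Ss : S `<=` adj S by rewrite -Sa.
have Sn' := (nonnegP Ss).1 Sn.
set M := ortho (lr_mul S).
have Mul := mul_subspace Sl.
have Ms : is_subspace M := ortho_subspace _.
have /choice[rs rsP] a : exists x, S (x, a - x).
  have [x [z [xz <-]]] := add_id_surj Sa Sn a.
  by exists x; rewrite addrC addKr.
have rsE x z : S (x, z) -> rs (x + z) = x.
  move=> xz; have /= hd := subspaceB Sl (rsP (x + z)) xz.
  set y := rs (x + z) in hd *; have /Sn' : S (y - x, - (y - x)).
    have <- : x + z - y - z = - (y - x) by rewrite addrAC addrK opprB.
    exact: hd.
  rewrite ripNl oppr_ge0 => h.
  have /rip_eq0/eqP : rip (y - x) (y - x) = 0 by apply/le_anti; rewrite h rip_ge0.
  by rewrite subr_eq0 => /eqP.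
have rs_symm : symm_op rs.
  move=> a b; have := Ss _ (rsP a) _ _ (rsP b) => /= h.
  by move: h; rewrite !innerDl !innerDr !innerNl !innerNr => /addIr ->.
have rs_le a : nm (rs a) <= nm a /\ nm (a - rs a) <= nm a.
  have := Sn' _ _ (rsP a); have := rip_ge0 (rs a); have := rip_ge0 (a - rs a).
  rewrite -!(@ler_pXn2r _ 2 _ _ (nm a)) ?nnegrE ?nm_ge0 // -!rip_nm.
  by rewrite !ripE (ripC a (rs a)) => h1 h2 h3; split; lra.
have [P [Ps Pc PP PC]] := operator_sqrt rs_symm (fun a => (rs_le a).2).
have id_rs_le x : nm (x - (x - rs x)) <= nm x by rewrite subKr; exact: (rs_le x).1.
have [N [Ns Nc NN NC]] := operator_sqrt (symm_id_sub rs_symm) id_rs_le.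
have Pb x : nm (P x) <= 2 * nm x.
  have := nm_tri x (P x) 0; rewrite !subr0 (nmB (P x)); have := Pc x; lra.
have PR x : P (rs x) = rs (P x).
  by rewrite (PC rs 1) // => y; rewrite mul1r (rs_le y).1.
have PN x : P (N x) = N (P x).
  by apply: (NC P 2) => // y; rewrite (symm_opB _ _ Ps) PR.
(* A root of [N] shows that the product of the commuting [N] and [P] is nonnegative. *)
have [N1 [N1s N1c N1N N1C]] := operator_sqrt Ns Nc.
have PN1 x : P (N1 x) = N1 (P x) by apply: (N1C P 2).
have Ppos x : 0 <= rip (P x) x.
  have := ler_norm (rip (x - P x) x); have := rip_le (x - P x) x.
  have := ler_wpM2r (nm_ge0 x) (Pc x); rewrite -expr2 -rip_nm !ripE; lra.
have PNpos x : 0 <= rip (N x) (P x).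
  by rewrite -N1N (symm_rip _ _ N1s) -PN1 ripC.
have rsM a : M (rs a).
  by move=> d Sd; have /= <- := Ss _ (rsP a) _ _ Sd; rewrite inner0r.
have rs_mul d : lr_mul S d -> rs d = 0 by move=> /rsE; rewrite add0r.
have mul_rs d : rs d = 0 -> lr_mul S d.
  by move=> d0; have := rsP d; rewrite d0 subr0.
have rs_orthoM d : ortho M d -> rs d = 0.
  by move=> dM; apply: rip_eq0; rewrite (symm_rip _ _ rs_symm) /rip dM.
have P0 d : rs d = 0 -> P d = 0.
  by move=> d0; apply: rip_eq0; rewrite (symm_rip _ _ Ps) PP d0 rip0r.
have PM a : M (P a).
  by move=> d /rs_mul/P0 d0; rewrite Ps d0 inner0r.
have NM a : M a -> M (N a).
  move=> aM d /rs_mul d0; rewrite Ns aM //; apply: mul_rs.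
  by rewrite -PP PN (P0 d d0) (symm_op0 Ns) (symm_op0 Ps).
have PPNN x : P (P x) + N (N x) = x by rewrite PP NN addrC subrK.
pose Q : set (H * H) := [set u | exists2 a, M a & u = (P a, N a)].
have Qsymm : Q `<=` adj Q.
  move=> _ [a aM ->] _ _ [b bM [-> ->]] /=.
  by rewrite -Ps PN Ns.
have Ql : is_linrel Q.
  split; first by exists 0; [exact: (subspace0 Ms)|rewrite (symm_op0 Ps) (symm_op0 Ns)].
  move=> t _ _ [a aM ->] [b bM ->]; exists (t *: a + b); first exact: (subspaceP t Ms aM bM).
  by rewrite (symm_opP _ _ _ Ps) (symm_opP _ _ _ Ns).
exists Q; split; first split.
- apply/seteqP; split=> [u Qu|[x x'] [/= xx [/= xM x'M]]].
    split; first exact: Qsymm.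
    by case: Qu => a aM -> ; split; [exact: PM|exact: NM].
  have E : P x' = N x.
    apply/eqP; rewrite -subr_eq0; apply/eqP/rip_eq0.
    have bM : M (P x' - N x) by exact: (subspaceB Ms (PM _) (NM _ xM)).
    move: bM; set b := P x' - N x => bM.
    have /= h : inner x' (P b) = inner x (N b) by apply: xx; exists b.
    by rewrite {1}/b ripDl ripNl !(symm_rip _ _ Ps, symm_rip _ _ Ns) /rip h subrr.
  exists (P x + N x'); first by exact: (subspaceD Ms (PM _) (NM _ x'M)).
  by rewrite (symm_opD _ _ Ps) (symm_opD _ _ Ns) (PN x') E PPNN -(PN x) -E PPNN.
- apply/seteqP; split=> [y [a aM [/esym Pa ->]]|_ ->]; last exact: subspace0 Ql.
  have /mul_rs Sa0 : rs a = 0 by rewrite -PP Pa (symm_op0 Ps).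
  have -> : a = 0 by apply: rip_eq0; rewrite /rip aM.
  exact: symm_op0.
- by apply/nonnegP => // _ _ [a aM [-> ->]].
- apply/seteqP; split=> [[x z] [y [a aM [-> ->]] [b bM [ab ->]]]|].
    pose v := P a + N b.
    have Pv : P v = a by rewrite /v (symm_opD _ _ Ps) PN -ab PPNN.
    have Nv : N v = b by rewrite /v (symm_opD _ _ Ns) -PN ab PPNN.
    exists (N b).
      by have := rsP v; rewrite -PP Pv -{2}Pv PP -NN Nv.
    by split=> /=; [exact: NM|rewrite subrr; exact: subspace0 (ortho_subspace _)].
  move=> [x z] [z' Sxz' [/= zM zz']].
  pose m := x + z.
  have xm : rs m = x.
    have -> : m = (x + z') - (z' - z) by rewrite opprB addrACA subrr addr0.
    by rewrite (symm_opB _ _ rs_symm) (rsE _ _ Sxz') rs_orthoM // subr0.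
  have mM : M m by (have xM : M x by rewrite -xm); exact: (subspaceD Ms xM zM).
  exists (P (N m)); first by exists (P m) => //; rewrite PP xm -PN.
  have zE : m - x = z by rewrite /m addrC addKr.
  by exists (N m); [exact: NM|rewrite NN xm zE].
Qed.

End OperatorPart.

(** * The form of a nonnegative selfadjoint relation *)

Section SqrtProperties.
Context {R : realType} {H : hilbertType R}.

Lemma op_part_sqrtP (S : set (H * H)) : selfadj S -> nonneg S ->
  nonneg_selfadj_op_in (ortho (lr_mul S)) (op_part_sqrt S) /\
  op_part_sqrt S ** op_part_sqrt S = op_part S.
Proof. by move=> Sa Sn; have := getPex (sqrt_exists Sa Sn). Qed.

Context (S : set (H * H)) (Sa : selfadj S) (Sn : nonneg S).
Let M := ortho (lr_mul S).
Let Q := op_part_sqrt S.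

Lemma selfadj_lin : is_linrel S.
Proof. by rewrite Sa; exact: adj_lin. Qed.

Let Ms : is_subspace M := ortho_subspace _.
Let QE : Q = adj Q `&` (M `*` M).
Proof. by have [[]] := op_part_sqrtP Sa Sn. Qed.
Let Q_mul v : Q (0, v) -> v = 0.
Proof. by have [[_ QM _] _] := op_part_sqrtP Sa Sn => h; have : lr_mul Q v by []; rewrite QM. Qed.
Let QQ : Q ** Q = op_part S.
Proof. by have [] := op_part_sqrtP Sa Sn. Qed.

Lemma sqrt_lin : is_linrel Q.
Proof.
rewrite QE; split; first by split; [exact: (subspace0 (adj_lin Q))|split; exact: (subspace0 Ms)].
move=> a u v [u1 [u2 u3]] [v1 [v2 v3]]; split; first exact: (subspaceP a (adj_lin Q) u1 v1).
by split; [exact: (subspaceP a Ms u2 v2)|exact: (subspaceP a Ms u3 v3)].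
Qed.

Lemma sqrt_dom x v : Q (x, v) -> M x /\ M v.
Proof. by rewrite QE => -[_]. Qed.

Lemma sqrt_symm x v y w : Q (x, v) -> Q (y, w) -> rip v y = rip x w.
Proof. by apply: rip_sym; rewrite {1}QE => ? []. Qed.

Lemma sqrt_fun x v v' : Q (x, v) -> Q (x, v') -> v = v'.
Proof.
move=> h h'; have := subspaceB sqrt_lin h h'; rewrite /= => hB.
have : Q (x - x, v - v') by exact: hB.
by rewrite subrr => /Q_mul/eqP; rewrite subr_eq0 => /eqP.
Qed.

Lemma sqrt_maximal x w : M x -> M w ->
  (forall v v', Q (v, v') -> rip w v = rip x v') -> Q (x, w).
Proof.
move=> Mx Mw h; rewrite QE; split; last by [].
by apply/adjP => //; exact: sqrt_lin.
Qed.

Lemma ortho_mul_approx x : (forall e, 0 < e -> exists2 m, M m & nm (m - x) < e) -> M x.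
Proof. by move=> h; apply: ortho_approx => //; apply: mul_subspace; exact: selfadj_lin. Qed.

Lemma sqrt_closure x v : closure Q (x, v) -> Q (x, v).
Proof.
move=> /closureP h; rewrite QE; split.
  apply: closed_approx; first by apply: adj_closed; exact: sqrt_lin.
  by move=> e /h[u]; rewrite {1}QE => -[Qu _] ux; exists u.
split=> /=; apply: ortho_mul_approx => e /h[[y w] /sqrt_dom[My Mw] [/= h1 h2]].
  by exists y.
by exists w.
Qed.

Lemma sqrt_val u z : S (u, z) -> exists2 w, Q (u, w) &
  forall x v, Q (x, v) -> rip v w = rip x z.
Proof.
move=> uz; have [p Mp zp] := ortho_orthoproj z (mul_subspace selfadj_lin).
have : (Q ** Q) (u, p) by rewrite QQ; exists z.
move=> [w uw wp]; exists w => // x v xv.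
have [Mx _] := sqrt_dom xv.
have zp0 : rip (z - p) x = 0 by rewrite /rip (zp _ Mx).
by move: zp0; rewrite (sqrt_symm xv wp) !ripE (ripC z) (ripC p); lra.
Qed.

Lemma sqrt_sqr u w p : Q (u, w) -> Q (w, p) ->
  exists2 z, S (u, z) & forall x, M x -> rip z x = rip p x.
Proof.
move=> uw wp; have : (Q ** Q) (u, p) by exists w.
rewrite QQ => -[z uz [/= Mp zp]]; exists z => // x Mx.
have zp0 : rip (z - p) x = 0 by rewrite /rip (zp _ Mx).
by move: zp0; rewrite !ripE; lra.
Qed.

Lemma sqrt_surj a : M a -> exists u w p, [/\ Q (u, w), Q (w, p) & u + p = a].
Proof.
move=> Ma; have [x [y [/sqrt_closure xy E]]] := graph_projection a 0 sqrt_lin.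
have [Mx My] := sqrt_dom xy.
exists x, y, (a - x); split; [by []| |by rewrite addrC subrK].
apply: sqrt_maximal => //; first exact: (subspaceB Ms Ma Mx).
by move=> v v' /E; rewrite sub0r ripNl; lra.
Qed.

(** The pair left over after projecting [(x, v)] onto the closure of the square
    root restricted to the domain of its square has a first component orthogonal
    to the range of [1 + Q^2], which is all of [M]. *)
Lemma sqrt_core x v e : Q (x, v) -> 0 < e -> exists u z w,
  [/\ S (u, z), Q (u, w), nm (u - x) < e & nm (w - v) < e].
Proof.
move=> xv e0; pose D : set (H * H) := Q `&` [set u | exists p, Q (u.2, p)].
have Dl : is_linrel D.
  split; first by split; [exact: (subspace0 sqrt_lin)|exists 0; exact: (subspace0 sqrt_lin)].
  move=> a u u' [Qu [p pu]] [Qu' [p' pu']]; split; first exact: (subspaceP a sqrt_lin Qu Qu').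
  by exists (a *: p + p'); exact: (subspaceP a sqrt_lin pu pu').
have [x0 [v0 [D0 E]]] := graph_projection x v Dl.
have Q0 : Q (x0, v0).
  by apply: sqrt_closure; move: D0; apply: closure_subset => u [].
have Qd : Q (x - x0, v - v0) := subspaceB sqrt_lin xv Q0.
have [Md _] := sqrt_dom Qd.
have [u [w [p [uw wp up]]]] := sqrt_surj Md.
have Duw : D (u, w) by split=> //; exists p.
have := E _ _ Duw; rewrite (sqrt_symm Qd wp) -ripDr up => /rip_eq0 xx.
have xE : x0 = x by apply/esym/eqP; rewrite -subr_eq0 xx.
rewrite xE in Q0 D0; rewrite (sqrt_fun Q0 xv) in D0.
have /closureP/(_ _ e0)[[u' w'] [/= uw' [p' wp']] [h1 h2]] := D0.
by have [z uz _] := sqrt_sqr uw' wp'; exists u', z, w'.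
Qed.

(** The functional [Q u |-> S u . x] is bounded, hence represented by some [k] in
    the closure of the range of [Q].  Projecting [(x, k)] onto the graph of [Q]
    leaves a pair that is again, rotated, in the graph of [Q]; pairing it with
    the range of [1 + Q^2] shows that the pair [(x, k)] lies in [Q]. *)
Lemma sqrt_form_dom x c : 0 <= c ->
    (forall u z, S (u, z) -> rip z x ^+ 2 <= c ^+ 2 * rip z u) ->
  exists2 w, Q (x, w) & nm w <= c.
Proof.
move=> c0 bnd.
have Mx : M x.
  apply: (ortho_ripP x (mul_subspace selfadj_lin)).2 => d /bnd.
  rewrite rip0r mulr0 => h; apply/eqP; rewrite -sqrf_eq0 ripC.
  by apply/eqP/le_anti; rewrite h sqr_ge0.
pose D : set (H * H) := Q `&` [set u | exists v, Q (v, u.1)].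
have Dl : is_linrel D.
  split; first by split; [exact: (subspace0 sqrt_lin)|exists 0; exact: (subspace0 sqrt_lin)].
  move=> a u u' [Qu [p pu]] [Qu' [p' pu']]; split; first exact: (subspaceP a sqrt_lin Qu Qu').
  by exists (a *: p + p'); exact: (subspaceP a sqrt_lin pu pu').
have [|||k [kD kE kc]] := @riesz_extension R H (H * H)%type fst (fun u => rip u.2 x)
   D c Dl c0.
- by [].
- by move=> t u v /=; rewrite !ripE.
- move=> [w p] [/= wp [u uw]]; apply: le_trans (ler_norm _) _.
  rewrite -(@ler_pXn2r _ 2) ?nnegrE ?mulr_ge0 ?nm_ge0 // real_normK ?num_real //.
  have [z uz zE] := sqrt_sqr uw wp; have [Mu _] := sqrt_dom uw.
  by have := bnd _ _ uz; rewrite !zE // exprMn -rip_nm (sqrt_symm wp uw).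
have Mk : M k.
  apply: ortho_mul_approx => e /kD[[w p] [/= /sqrt_dom[Mw _] _]] wk.
  by exists w.
have [x0 [w0 [/sqrt_closure Q0 E]]] := graph_projection x k sqrt_lin.
have [Mx0 Mw0] := sqrt_dom Q0.
have Qa : Q (k - w0, - (x - x0)).
  apply: sqrt_maximal; [exact: (subspaceB Ms Mk Mw0)|exact: (subspaceN Ms (subspaceB Ms Mx Mx0))|].
  by move=> v v' /E; rewrite ripNl; lra.
have [u [w [p [uw wp up]]]] := sqrt_surj (subspaceB Ms Mx Mx0).
have Dwp : D (w, p) by split=> //; exists u.
have xx0 : x = x0.
  apply/eqP; rewrite -subr_eq0; apply/eqP/rip_eq0.
  have := kE _ Dwp; have := sqrt_symm wp Q0; have := sqrt_symm uw Qa.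
  rewrite -[X in _ -> _ -> _ -> rip X _ = _]up /= !ripE (ripC w k); lra.
move: Qa Q0; rewrite xx0 subrr oppr0 => Qa Q0.
have wk : w0 = k.
  apply/esym/eqP; rewrite -subr_eq0; apply/eqP/rip_eq0.
  have := sqrt_symm Qa Q0; rewrite rip0l => h0.
  rewrite ripDr ripNr -h0 oppr0 addr0.
  have aM : ortho D.`1 (k - w0).
    apply/ortho_ripP => [|w' [p' [/= wp' [u' uw']]]]; first exact: dom_subspace.
    by have := sqrt_symm Qa uw'; rewrite rip0l => <-.
  have kDD : ortho (ortho D.`1) k.
    apply: ortho2_approx; first exact: dom_subspace.
    by move=> e /kD[[w' p'] Dw wk]; exists w' => //; exists p'.
  by rewrite ripC /rip kDD.
by exists k => //; rewrite -wk.
Qed.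

End SqrtProperties.

(** * The order of selfadjoint relations and bounded nonnegative operators *)

Section Order.
Context {R : realType}.
Implicit Types H K : hilbertType R.

(** The bound extends from the domain of [C] to the domain of its square root,
    because the former is a core; it then places the vector in the domain of the
    square root of [D] with the right norm. *)
Lemma lr_le_of_form_bound H (D C : set (H * H)) :
    selfadj C -> nonneg C -> selfadj D -> nonneg D ->
    (forall u z x c, D (u, z) -> C (x, c) ->
       rip z x ^+ 2 <= rip z u * rip c x) ->
  D <=r C.
Proof.
move=> Ca Cn Da Dn DC.
have Dpos u z : D (u, z) -> 0 <= rip z u.
  by apply: (nonnegP _).1 => //; rewrite -Da.
have key x c : op_part_sqrt C (x, c) ->
    exists2 d, op_part_sqrt D (x, d) & nm d <= nm c.
  move=> xc; apply: sqrt_form_dom => //; first exact: nm_ge0.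
  move=> u z uz; set k := Num.sqrt (rip z u).
  have k0 : 0 <= k by exact: sqrtr_ge0.
  have kE : k ^+ 2 = rip z u by rewrite sqr_sqrtr // Dpos.
  rewrite mulrC -kE -exprMn -[X in X <= _]real_normK ?num_real //.
  rewrite ler_pXn2r ?nnegrE ?mulr_ge0 ?nm_ge0 //.
  apply: (@le_eps_mul _ _ _ (k + nm z)); first by rewrite addr_ge0 ?nm_ge0.
  move=> e e0; have [x' [c' [w [x'c' x'w h1 h2]]]] := sqrt_core Ca Cn xc e0.
  have [w' x'w' w'E] := sqrt_val Ca Cn x'c'.
  have wE : rip c' x' = nm w ^+ 2.
    by rewrite -rip_nm {2}(sqrt_fun Ca Cn x'w x'w') (w'E _ _ x'w) ripC.
  have h3 : `|rip z x'| <= k * nm w.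
    rewrite -(@ler_pXn2r _ 2) ?nnegrE ?mulr_ge0 ?nm_ge0 //.
    by rewrite real_normK ?num_real // exprMn kE -wE DC.
  have h4 := ripB_le x' z x; rewrite !(ripC _ z) in h4.
  have h5 := ler_wpM2r (nm_ge0 z) (ltW h1).
  have h6 := nm_tri c w 0; rewrite !subr0 in h6.
  have h7 : k * nm w <= k * (nm c + e) by apply: ler_wpM2l => //; lra.
  have h8 : `|rip z x| <= `|rip z x'| + `|rip z x' - rip z x|.
    by rewrite -{1}(subKr (rip z x') (rip z x)) ler_normB.
  lra.
split=> //; first by move=> x [c /key[d xd _]]; exists d.
move=> x c d /key[d' xd' dc] xd.
by rewrite (sqrt_fun Da Dn xd xd') !normE lecR.
Qed.

Lemma adj_prod_sqrt H K (T : set (H * K)) x y : is_linrel T -> closed T ->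
  T (x, y) -> exists2 w, op_part_sqrt (adj T ** T) (x, w) & nm w <= nm y.
Proof.
move=> Tl Tc xy; apply: sqrt_form_dom; rewrite ?nm_ge0 //.
- exact: adj_prod_selfadj.
- exact: adj_prod_nonneg.
move=> u z [v uv /(adjP _ _ Tl) vz].
by rewrite (vz _ _ xy) (vz _ _ uv) -rip_nm mulrC cauchy_schwarz.
Qed.

Lemma selfadj_scale H (S : set (H * H)) (a : R) : 0 < a -> selfadj S ->
  selfadj (lr_scale a S).
Proof.
move=> a0 Sa.
have aC0 : a%:C != 0 by rewrite -(rmorph0 (real_complex R)) (inj_eq (@complexI R)) gt_eqF.
have aconj : Num.conj a%:C = a%:C by rewrite conjE /= oppr0.
apply/seteqP; split=> [[x _] [z /= xz ->] y w [y' yy' /= ->] |[x x'] h].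
  rewrite /= innerZl innerZr aconj; congr (_ * _).
  by move: xz; rewrite Sa; apply.
exists (a%:C^-1 *: x'); last by rewrite /= scalerA divff // scale1r.
rewrite Sa => y y' yy' /=.
have /= := h y (a%:C *: y') (ex_intro2 _ _ y' yy' erefl).
rewrite innerZl innerZr aconj => ->.
by rewrite mulrA mulVf // mul1r.
Qed.

Lemma nonneg_scale H (S : set (H * H)) (a : R) : 0 < a -> nonneg S ->
  nonneg (lr_scale a S).
Proof.
move=> a0 Sn x _ [z /= /Sn xz ->].
by rewrite innerZl mulr_ge0 // lecR ltW.
Qed.

Lemma bounded_nonnegP K (A : set (K * K)) : bounded_nonneg A ->
  [/\ forall y, exists g, A (y, g),
      forall y g g', A (y, g) -> A (y, g') -> g = g',
      forall x g y h, A (x, g) -> A (y, h) -> rip g y = rip x h,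
      forall x g, A (x, g) -> 0 <= rip g x
    & exists2 c, 0 <= c & forall x g, A (x, g) -> nm g <= c * nm x].
Proof.
move=> [Al Am Ad [M AM] [Aa An]]; have Asub : A `<=` adj A by rewrite -Aa.
split=> [y|y g g' yg yg'|x g y h||].
- have : A.`1 y by rewrite Ad.
  by case=> g; exists g.
- have : lr_mul A (g - g').
    have : A (y - y, g - g') := subspaceB Al yg yg'.
    by rewrite subrr.
  by rewrite Am => /eqP; rewrite subr_eq0 => /eqP.
- exact: rip_sym.
- exact: (nonnegP Asub).1.
- exists `|M| => // x g /AM; rewrite !normE -rmorphM lecR => /le_trans; apply.
  by rewrite ler_wpM2r ?nm_ge0 ?ler_norm.
Qed.

Lemma nonneg_cauchy_schwarz K (A : set (K * K)) x g y h : bounded_nonneg A ->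
  A (x, g) -> A (y, h) -> rip g y ^+ 2 <= rip g x * rip h y.
Proof.
move=> Ab xg yh; have [Al _ _ _ _] := Ab.
have [_ _ Asym Apos _] := bounded_nonnegP Ab.
apply: discriminant_le => [|t]; first exact: Apos.
have := Apos _ _ (subspaceP t%:C Al yh xg).
rewrite !ripE (ripC h x) -(Asym _ _ _ _ xg yh); lra.
Qed.

End Order.

(** * Factorizations and form inequalities *)

Section Factorization.
Context {R : realType} {H K : hilbertType R}.
Implicit Types (T : set (H * K)) (Y : set (K * K)).

(** The chain of inclusions [S <= closure B0 Y B0^* <= T^* B0^* <= S^*] closes up
    since [S] is selfadjoint. *)
Lemma factor_identities T (B0 : set (K * H)) Y :
    selfadj (closure B0 ** T) -> bounded_nonneg (Y^-1)%relation ->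
    T `<=` Y ** adj B0 ->
  closure B0 ** T = closure B0 ** Y ** adj B0 /\
  closure B0 ** Y ** adj B0 = adj T ** adj B0.
Proof.
move=> Sa Yb TY; have [_ _ _ _ [Ya _]] := Yb.
have cB : closure B0 `<=` adj (adj B0) := @closure_sub_adj_adj _ _ _ B0.
have sub1 : closure B0 ** T `<=` closure B0 ** Y ** adj B0.
  move=> [x z] [y /TY[w xw wy] yz]; exists w => //; exists y => //.
have sub2 : closure B0 ** Y ** adj B0 `<=` adj T ** adj B0.
  move=> [x z] [w xw [y wy yz]]; exists w => // u v /TY[g ug gv] /=.
  have /= -> := cB _ yz _ _ ug.
  have : adj (Y^-1)%relation (y, w) by rewrite -Ya.
  by move=> /(_ _ _ gv) /= ->.
have sub3 : adj T ** adj B0 `<=` closure B0 ** T.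
  rewrite Sa; apply: subset_trans (@adj_prod _ _ _ _ _ _).
  move=> [x z] [w xw wz]; exists w => // k h kh /=.
  have /= hk := cB _ kh _ _ xw.
  by rewrite [LHS]innerC -hk -innerC.
split; apply/seteqP; split=> //.
  exact: subset_trans sub2 sub3.
exact: subset_trans sub3 sub1.
Qed.

(** Writing [G] for the inverse of [Y], the form of the product is that of [G];
    the bound [c] of [G] yields [eta = 1 / (c + 1)]. *)
Lemma factor_form_le T (B0 : set (K * H)) Y : is_linrel T -> closed T ->
    selfadj (closure B0 ** T) -> bounded_nonneg (Y^-1)%relation ->
    T `<=` Y ** adj B0 ->
  exists eta : R, [/\ 0 < eta, lr_scale eta (closure B0 ** T) <=r adj T ** T
    & nonneg (lr_scale eta (closure B0 ** T))].
Proof.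
move=> Tl Tc Sa Yb TY; set S := closure B0 ** T.
have [_ Yfun Ysym Ypos [c c0 Yc]] := bounded_nonnegP Yb.
have cB : closure B0 `<=` adj (adj B0) := @closure_sub_adj_adj _ _ _ B0.
have formE x w v z : adj B0 (x, w) -> closure B0 (v, z) -> rip z x = rip w v.
  by move=> xw /cB/(_ _ _ xw) /= E; rewrite [RHS]ripC /rip E.
have Sn : nonneg S.
  have Ssub : S `<=` adj S by rewrite -Sa.
  apply/(nonnegP Ssub) => x z [y xy yz]; have [w xw wy] := TY _ xy.
  by rewrite (formE _ _ _ _ xw yz) (Ypos _ _ wy).
(* The bound [c] may vanish, hence the shift by 1. *)
pose eta := (c + 1)^-1.
have eta0 : 0 < eta by rewrite invr_gt0; lra.
have etac : eta * c <= 1.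
  by rewrite mulrC ler_pdivrMr ?mul1r; lra.
exists eta; split=> //; last exact: nonneg_scale.
apply: lr_le_of_form_bound.
- exact: adj_prod_selfadj.
- exact: adj_prod_nonneg.
- exact: selfadj_scale.
- exact: nonneg_scale.
move=> u z x d [z' /= [y' uy' yz'] ->] [y xy /(adjP _ _ Tl) yd].
rewrite (yd _ _ xy) !ripZl.
have [w xw wy] := TY _ xy; have [w' xw' wy'] := TY _ uy'.
rewrite (formE _ _ _ _ xw yz') (formE _ _ _ _ xw' yz').
have h1 := nonneg_cauchy_schwarz Yb wy wy'.
have h2 : rip w y <= c * rip y y.
  rewrite rip_nm expr2 mulrA; apply: le_trans (ler_norm _) _.
  by apply: le_trans (rip_le _ _) _; apply: ler_wpM2r; rewrite ?nm_ge0 ?Yc.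
have h3 := Ypos _ _ wy'; have h4 := rip_ge0 y.
rewrite exprMn.
have h5 : eta ^+ 2 * rip w y' ^+ 2 <= eta ^+ 2 * ((c * rip y y) * rip w' y').
  apply: ler_wpM2l; first exact: sqr_ge0.
  by apply: le_trans h1 _; apply: ler_wpM2r.
apply: le_trans h5 _.
have h6 : 0 <= eta * rip y y * rip w' y' by rewrite !mulr_ge0 // ltW.
have := ler_wpM2r h6 etac; lra.
Qed.

(** With [W] the continuous extension of [L] that vanishes on the orthogonal
    complement of the domain of [L], the relation [A] is [adj W ** W].  Here
    [E] is [adj W], obtained from [adj L] by discarding its multivalued part, and
    [F = adj E] is [W]. *)
Lemma adj_factor_bounded_nonneg (L : set (K * H)) (s : R) :
    is_linrel L -> 0 <= s -> (forall y w, L (y, w) -> nm w <= s * nm y) ->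
  exists A : set (K * K), [/\ bounded_nonneg A,
    forall y w g, L (y, w) -> A (y, g) -> adj L (w, g),
    forall y, L (y, 0) -> A (y, 0) &
    forall y, ortho L.`1 y -> A (y, 0)].
Proof.
move=> Ll s0 Lb.
pose E : set (H * K) := adj L `&` [set u | ortho (ortho L.`1) u.2].
have El : is_linrel E.
  split; first by split; [exact: (subspace0 (adj_lin L))|exact: (subspace0 (ortho_subspace _))].
  move=> a u v [u1 u2] [v1 v2]; split; first exact: (subspaceP a (adj_lin L) u1 v1).
  exact: (subspaceP a (ortho_subspace _) u2 v2).
have E0 k : E (0, k) -> k = 0.
  move=> [k1 /= k2]; apply: rip_eq0; rewrite /rip k2 //.
  by have : lr_mul (adj L) k by []; rewrite mul_adj.
have Eex h : exists2 k, E (h, k) & nm k <= s * nm h.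
  by have [k [k1 k2 k3]] := adj_total_of_bounded Ll s0 Lb h; exists k.
have Eb h k : E (h, k) -> nm k <= s * nm h.
  move=> hk; have [k' hk' kb] := Eex h.
  have /E0/eqP : E (0, k - k').
    by have : E (h - h, k - k') := subspaceB El hk hk'; rewrite subrr.
  by rewrite subr_eq0 => /eqP ->.
have Edom : E.`1 = setT.
  by apply/seteqP; split=> // h _; have [k hk _] := Eex h; exists k.
pose F := adj E.
have Fl : is_linrel F := adj_lin E.
have F0 h : F (0, h) -> h = 0.
  move=> h0; have : lr_mul (adj E) h by [].
  by rewrite mul_adj Edom => hT; apply: rip_eq0; rewrite /rip hT.
have Fex k : exists2 h, F (k, h) & nm h <= s * nm k.
  by have [h [h1 h2 h3]] := adj_total_of_bounded El s0 Eb k; exists h.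
have Ffun k h h' : F (k, h) -> F (k, h') -> h = h'.
  move=> kh kh'; have /F0/eqP : F (0, h - h').
    by have : F (k - k, h - h') := subspaceB Fl kh kh'; rewrite subrr.
  by rewrite subr_eq0 => /eqP.
have LF : L `<=` F.
  by apply: subset_trans (@sub_adj_adj _ _ _ L) _; apply: adj_mono => u [].
exists (E ** F); split.
- have Al := prod_lin El Fl.
  have Asub : E ** F `<=` adj (E ** F).
    apply: subset_trans (@adj_prod _ _ _ _ _ _) => -[x z] [h xh hz].
    by exists h => //; exact: sub_adj_adj.
  have Aex k : exists k', (E ** F) (k, k').
    by have [h kh _] := Fex k; have [k' hk' _] := Eex h; exists k', h.
  split=> //.
  + apply/seteqP; split=> [k [h /F0 -> /E0]//|_ ->]; exact: (subspace0 Al).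
  + by apply/seteqP; split=> // k _; exact: Aex.
  + exists (s ^+ 2) => k k' [h kh /Eb hk'].
    have [h' kh' hb] := Fex k; rewrite (Ffun _ _ _ kh' kh) in hb.
    rewrite !normE -rmorphM lecR (le_trans hk') // expr2 -mulrA.
    exact: ler_wpM2l.
  + split; first (apply/seteqP; split=> // -[x x'] xx').
      have [x'' xx''] := Aex x.
      suff -> : x' = x'' by [].
      have : lr_mul (adj (E ** F)) (x' - x'').
        have : adj (E ** F) (x - x, x' - x'') := subspaceB (adj_lin _) xx' (Asub _ xx'').
        by rewrite subrr.
      rewrite mul_adj => h; apply/eqP; rewrite -subr_eq0; apply/eqP/rip_eq0.
      by rewrite /rip h //; exact: Aex.
    apply/(nonnegP Asub) => k k' [h kh hk'].
    have /= := kh _ _ hk'; rewrite ripC /rip => <-; exact: rip_ge0.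
- move=> y w g /LF yw [h yh [hg _]].
  by rewrite (Ffun _ _ _ yw yh).
- by move=> y /LF y0; exists 0 => //; exact: (subspace0 El).
- move=> y yL; exists 0; last exact: (subspace0 El).
  by move=> h k [_ /= kL]; rewrite [RHS]innerC kL // innerE !rip0l conjE /= oppr0.
Qed.

(** [L] sends [y] to [eta^(-1/2) Q x] for [(x, y)] in [T], where [Q] is the square
    root attached to [eta] times the product; the inequality makes it bounded by
    [eta^(-1/2)], and it vanishes on [lr_mul T]. *)
Lemma form_le_factor T (B0 : set (K * H)) (eta : R) : is_linrel T -> closed T -> is_linrel B0 ->
    selfadj (closure B0 ** T) ->
    (forall k h, B0 (k, h) -> exists x y, [/\ T (x, y), closure B0 (y, h) &
       sumset (lr_ker (adj T)) (lr_mul T) (k - y)]) ->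
    0 < eta -> lr_scale eta (closure B0 ** T) <=r adj T ** T ->
  exists Y, [/\ is_linrel Y, bounded_nonneg (Y^-1)%relation,
    T `<=` Y ** adj B0 &
    sumset (lr_ker (adj T)) (lr_mul T) `<=` lr_mul Y].
Proof.
move=> Tl Tc Bl Sa Bran eta0 [[Ca Cn] [Da Dn] Cdom CD].
set C := adj T ** T in Ca Cn Cdom CD.
set D := lr_scale eta _ in Da Dn Cdom CD.
pose Q := op_part_sqrt D; pose s := Num.sqrt eta^-1.
have Ql : is_linrel Q := sqrt_lin Da Dn.
have s0 : 0 <= s := sqrtr_ge0 _.
have sE : s * s = eta^-1 by rewrite -expr2 sqr_sqrtr // invr_ge0 ltW.
have QT x y : T (x, y) -> exists2 v, Q (x, v) & nm v <= nm y.
  move=> xy; have [w xw wy] := adj_prod_sqrt Tl Tc xy.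
  have [|v xv] := Cdom x; first by exists w.
  exists v => //; apply: le_trans wy.
  by have := CD _ _ _ xw xv; rewrite !normE lecR.
pose L : set (K * H) :=
  [set u | exists x v, [/\ T (x, u.1), Q (x, v) & u.2 = s%:C *: v]].
have Ll : is_linrel L.
  split; first by exists 0, 0; rewrite scaler0; split=> //; [exact: (subspace0 Tl)|exact: (subspace0 Ql)].
  move=> a [y w] [y' w'] [x [v [/= xy xv ->]]] [x' [v' [/= xy' xv' ->]]].
  exists (a *: x + x'), (a *: v + v'); split=> /=.
  - exact: (subspaceP a Tl xy xy').
  - exact: (subspaceP a Ql xv xv').
  - by rewrite scalerDr !scalerA mulrC.
have Lb y w : L (y, w) -> nm w <= s * nm y.
  move=> [x [v [/= xy xv ->]]]; have [v' xv' vy] := QT _ _ xy.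
  rewrite (sqrt_fun Da Dn xv xv') nmZ ger0_norm //.
  exact: ler_wpM2l.
have [A [Ab AL A0 Aker]] := adj_factor_bounded_nonneg Ll s0 Lb.
have [Al _ _ _ _] := Ab.
have [Aex Afun Asym _ _] := bounded_nonnegP Ab.
have Asum k : sumset (lr_ker (adj T)) (lr_mul T) k -> A (k, 0).
  move=> [k1 k1T [k2 k2T <-]]; rewrite -[0]addr0; apply: (subspaceD Al (u := (_, _)) (v := (_, _))).
    apply: Aker => y [w [x [v [/= xy _ _]]]].
    by move: k1T; rewrite ker_adj; apply; exists x.
  apply: A0; exists 0, 0; rewrite scaler0; split=> //; exact: (subspace0 Ql).
exists (A^-1)%relation; split.
- split; first exact: (subspace0 Al).
  by move=> a [u u'] [v v'] hu hv; exact: (subspaceP a Al hu hv).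
- by have -> : ((A^-1)^-1)%relation = A by apply/seteqP; split=> -[].
- move=> [x y] xy; have [g yg] := Aex y; exists g => //.
  apply/adjP => // k h kh.
  have [x' [y' [xy' yh' /Asum ky]]] := Bran _ _ kh.
  have gk : rip g k = rip g y'.
    by have := Asym _ _ _ _ yg ky; rewrite rip0r !ripE; lra.
  have [v xv _] := QT _ _ xy; have [v' xv' _] := QT _ _ xy'.
  have yL : L (y, s%:C *: v) by exists x, v.
  have yL' : L (y', s%:C *: v') by exists x', v'.
  have /(adjP _ _ Ll)/(_ _ _ yL') := AL _ _ _ yL yg.
  have Dx : D (x', eta%:C *: h) by exists h => //; exists y'.
  have [v'' xv'' vE] := sqrt_val Da Dn Dx.
  rewrite gk !ripE mulrA sE -(sqrt_fun Da Dn xv'' xv') (vE _ _ xv) ripE.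
  by rewrite mulKf ?gt_eqF // => ->.
- by move=> k /Asum.
Qed.

End Factorization.

(** * Factorizations of the adjoint *)

Section Corollaries.
Context {R : realType} {H K : hilbertType R}.
Implicit Types (T : set (H * K)) (Y : set (K * K)).

(** The adjoint formulation of the inclusion; [factor_sub_adj] is the converse. *)
Lemma sub_factor_of_adj T (B0 : set (K * H)) Y : is_linrel B0 ->
    bounded_nonneg (Y^-1)%relation -> closure B0 ** Y `<=` adj T ->
  T `<=` Y ** adj B0.
Proof.
move=> Bl Yb BY [x y] xy; have [Yex _ Ysym _ _] := bounded_nonnegP Yb.
have [g gy] := Yex y; exists g => //; apply/adjP => // k h kh.
have [gk gkk] := Yex k.
have : adj T (gk, h) by apply: BY; exists k => //; exact: subset_closure.
move=> /(_ _ _ xy) /= E.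
by rewrite (Ysym _ _ _ _ gy gkk) ripC [RHS]ripC /rip E.
Qed.

Lemma factor_sub_adj T (B0 : set (K * H)) Y : is_linrel T ->
    bounded_nonneg (Y^-1)%relation -> T `<=` Y ** adj B0 ->
  closure B0 ** Y `<=` adj T.
Proof.
move=> Tl Yb TY [g h] [k gk kh]; have [_ _ Ysym _ _] := bounded_nonnegP Yb.
apply/adjP => // x y /TY[w xw wy].
have /= E := closure_sub_adj_adj kh xw.
by rewrite (Ysym _ _ _ _ gk wy) /rip E.
Qed.

(** An element [(k, h)] of the adjoint has the same second component as some
    [(g, h)] in the product, so [k - g] lies in the kernel of the adjoint.  The sum
    is direct because the inverse of [Y] annihilates the kernel of [closure B0]. *)
Lemma adj_direct_sum T (B0 : set (K * H)) Y : is_linrel T -> is_linrel B0 ->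
    is_linrel Y -> bounded_nonneg (Y^-1)%relation -> T `<=` Y ** adj B0 ->
    lr_ker (closure B0) `<=` lr_mul Y -> (adj T).`2 `<=` (closure B0).`2 ->
  is_direct_sum (adj T) (closure B0 ** Y) (lr_ker (adj T) `*` [set 0]).
Proof.
move=> Tl Bl Yl Yb TY kerY ranT.
have [Yex Yfun _ _ _] := bounded_nonnegP Yb.
have BYT := factor_sub_adj Tl Yb TY.
split; apply/seteqP; split=> [[k h] /=|].
- move=> [[w /= kw wh] [_ /= h0]]; rewrite h0 in wh *.
  by have -> : k = 0 := Yfun _ _ _ kw (kerY _ wh).
- move=> _ ->; split; last by split=> //; exact: (subspace0 (adj_lin T)).
  exists 0; first exact: (subspace0 Yl).
  by apply: subset_closure; exact: (subspace0 Bl).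
- move=> kh; have [w wh] := ranT h (ex_intro _ k kh).
  have [g wg] := Yex w.
  have gh : adj T (g, h) by apply: BYT; exists w.
  exists (g, h); first by exists w.
  exists (k - g, 0); last by congr (_, _); rewrite /= ?addr0 // subrKC.
  split=> //=; have : adj T (k - g, h - h) := subspaceB (adj_lin T) kh gh.
  by rewrite subrr.
- move=> _ [u /BYT uT [[k _] [/= kT ->] <-]].
  exact: (subspaceD (adj_lin T) uT kT).
Qed.

(** Subtract from [y] in [lr_mul Y] its projection onto the kernel of the adjoint.
    The rest is orthogonal to that kernel and to the range of the inverse of [Y],
    hence to the domain of [adj T], whose orthogonal complement is [lr_mul T]. *)
Lemma mul_factor T (B0 : set (K * H)) Y : is_linrel T -> closed T ->
    is_linrel Y -> bounded_nonneg (Y^-1)%relation ->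
    sumset (lr_ker (adj T)) (lr_mul T) `<=` lr_mul Y ->
    adj T `<=` sumset (closure B0 ** Y) (lr_ker (adj T) `*` [set 0]) ->
  sumset (lr_mul T) (lr_ker (adj T)) = lr_mul Y.
Proof.
move=> Tl Tc Yl Yb kY dec.
have [_ _ Ysym _ _] := bounded_nonnegP Yb.
apply/seteqP; split=> [y [m mT [k kT <-]]|y Yy].
  by rewrite addrC; apply: kY; exists k => //; exists m.
have kerE := ker_adj T.
have [k kT yk] := ortho_orthoproj y (ran_subspace Tl).
rewrite -kerE in kT yk.
have Yk : lr_mul Y k by apply: kY; exists k => //; exists 0; rewrite ?addr0 //; exact: (subspace0 Tl).
have Yyk : Y (0, y - k).
  by have : Y (0 - 0, y - k) := subspaceB Yl Yy Yk; rewrite subrr.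
exists (y - k); last by exists k => //; rewrite subrK.
have mulE : lr_mul T = ortho (adj T).`1 by rewrite -{1}(adj_adj Tl Tc) mul_adj.
rewrite mulE.
apply: (ortho_ripP _ (dom_subspace (adj_lin T))).2 => d [h dh].
have [[d1 h1] [w d1w _] [[d2 h2] [/= d2T _] E]] := dec _ dh.
have -> : d = d1 + d2 by case: E.
rewrite ripDr [X in _ + X]/rip (yk _ d2T) addr0.
by have := Ysym _ _ _ _ Yyk d1w; rewrite rip0l.
Qed.

End Corollaries.

Theorem theorem3p3 (R : realType) (H K : hilbertType R) (T B : set (H * K))
    (T_lin : is_linrel T) (T_closed : closed T)
    (B_lin : is_linrel B) (B_closed : closed B)
    (BT_selfadj : selfadj (adj B ** T)) :
  let B0 : set (K * H) := adj B `&` (setT `*` (adj B ** T).`2) in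
  let i := exists eta : R,
    [/\ 0 < eta,
        lr_scale eta (closure B0 ** T) <=r adj T ** T
      & nonneg (lr_scale eta (closure B0 ** T))] in
  let ii_sol (Y : set (K * K)) :=
    [/\ is_linrel Y, bounded_nonneg (Y^-1)%relation & T `<=` Y ** adj B0] in
  let iii :=
    (exists2 eta : R, 0 < eta &
       lr_scale eta (closure B0 ** T) <=r adj T ** T) /\
    (adj T).`2 `<=` (closure B0).`2 in
  let iv_sol (Y : set (K * K)) :=
    [/\ is_linrel Y, bounded_nonneg (Y^-1)%relation
      & is_direct_sum (adj T) (closure B0 ** Y)
          (lr_ker (adj T) `*` [set 0])] in
  lr_ker (adj B) `<=` sumset (lr_ker (adj T)) (lr_mul T) ->
  [/\ i <-> (exists Y, ii_sol Y),
      i -> exists Y,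
        [/\ ii_sol Y,
            sumset (lr_ker (adj T)) (lr_mul T) `<=` lr_mul Y,
            adj B ** T = closure B0 ** T,
            closure B0 ** T = closure B0 ** Y ** adj B0
          & closure B0 ** Y ** adj B0 = adj T ** adj B0],
      iii <-> (exists Y, iv_sol Y)
    & iii -> exists2 Y, iv_sol Y &
        sumset (lr_mul T) (lr_ker (adj T)) = lr_mul Y].
Proof.
move=> B0 i ii_sol iii iv_sol kerB.
have BTl : is_linrel (adj B ** T) := prod_lin (adj_lin B) T_lin.
have B0l : is_linrel B0.
  split; first by split; [exact: (subspace0 (adj_lin B))|split=> //; exact: (subspace0 (ran_subspace BTl))].
  move=> a u v [uB [_ uR]] [vB [_ vR]]; split; first exact: (subspaceP a (adj_lin B) uB vB).
  by split=> //; exact: (subspaceP a (ran_subspace BTl) uR vR).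
have cB0 : closure B0 `<=` adj B.
  rewrite [X in _ `<=` X](closure_id _).1; last exact: adj_closed.
  by apply: closure_subset => u [].
have BTE : adj B ** T = closure B0 ** T.
  apply/seteqP; split=> -[x z] [y xy yz]; exists y => //; last exact: cB0.
  by apply: subset_closure; split=> //; split=> //; exists x, y.
have Sa : selfadj (closure B0 ** T) by rewrite -BTE.
have Bran k h : B0 (k, h) -> exists x y, [/\ T (x, y), closure B0 (y, h) &
    sumset (lr_ker (adj T)) (lr_mul T) (k - y)].
  move=> [kB [_ [x [y xy yB]]]]; exists x, y; split=> //.
    by apply: subset_closure; split=> //; split=> //; exists x, y.
  by apply: kerB; have : adj B (k - y, h - h) := subspaceB (adj_lin B) kB yB; rewrite subrr.
have construct eta : 0 < eta ->
    lr_scale eta (closure B0 ** T) <=r adj T ** T ->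
    exists2 Y, ii_sol Y & sumset (lr_ker (adj T)) (lr_mul T) `<=` lr_mul Y.
  move=> eta0 le; have [Y [Yl Yb TY kY]] := form_le_factor T_lin T_closed B0l Sa Bran eta0 le.
  by exists Y.
have ii_i Y : ii_sol Y -> i.
  by move=> [_ Yb TY]; exact: factor_form_le TY.
have iii_iv : iii -> exists2 Y, iv_sol Y &
    sumset (lr_mul T) (lr_ker (adj T)) = lr_mul Y.
  move=> [[eta eta0 le] ranT]; have [Y [Yl Yb TY] kY] := construct _ eta0 le.
  have dec : is_direct_sum (adj T) (closure B0 ** Y) (lr_ker (adj T) `*` [set 0]).
    by apply: adj_direct_sum => // k /cB0 /kerB /kY.
  exists Y => //; apply: (@mul_factor R H K T B0 Y) => //.
  by move=> u; case: dec => _ {1}->.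
split.
- split=> [[eta [eta0 le _]]|[Y /ii_i//]].
  by have [Y iiY _] := construct _ eta0 le; exists Y.
- move=> [eta [eta0 le _]]; have [Y iiY kY] := construct _ eta0 le.
  have [_ Yb TY] := iiY; have [E1 E2] := factor_identities Sa Yb TY.
  by exists Y.
- split=> [/iii_iv[Y ivY _]|[Y [Yl Yb [_ dec]]]]; first by exists Y.
  have kT0 : (lr_ker (adj T) `*` [set 0]) 0 by split=> //; exact: (subspace0 (adj_lin T)).
  have BY : closure B0 ** Y `<=` adj T.
    by move=> u uY; rewrite dec; exists u => //; exists 0; rewrite ?addr0.
  have TY := sub_factor_of_adj B0l Yb BY.
  have [eta [eta0 le _]] : i by apply: (ii_i Y).
  split; first by exists eta.
  move=> h [k]; rewrite dec => -[[k1 h1] [w _ wh] [[k2 h2] [_ /= ->]]] [_ <-].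
  by rewrite addr0; exists w.
- exact: iii_iv.
Qed.
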